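(* There are absolute constants $\tilde c>0$ and $c>0$ such that the following holds. Let $g\ge 2$ be an integer that is an integral power of $2$, and let $G$ be a graph of maximum vertex degree at most $3$ that contains a hairy Path-of-Sets System of length $\ell=\tilde c\log g$ and width $\tilde w\geq g^2$, with clusters $C_1,\ldots,C_\ell$, sets $A_i,B_i,X_i\subseteq V(C_i)$, clusters $S_i$ with $Y_i\subseteq V(S_i)$, and path sets $\mathcal{Q}_i$ connecting $X_i$ to $Y_i$. Assume that for every odd integer $1\leq i\leq \ell$, the graph $C_i\cup\mathcal{Q}_i$ (the union of $C_i$ and the paths of $\mathcal Q_i$) contains an $(A_i,B_i,Y_i)$-crossbar of width $g^2$. Then $G$ contains the $(g'\times g')$-grid as a minor for some $g'\ge c\,g/\log^{1.5}g$.
   Context: Logarithms are base 2. Node-disjoint paths share no vertices; a set of paths connects $S$ to $T$ if each path has one endpoint in each. $T$ is node-well-linked in $C$ if for all disjoint $T',T''\subseteq T$ there are $\min(|T'|,|T''|)$ node-disjoint paths in $C$ connecting them; disjoint $(A,B)$ are linked in $C$ if for all $A'\subseteq A,B'\subseteq B$ there are $\min(|A'|,|B'|)$ node-disjoint paths in $C$ connecting them. A hairy Path-of-Sets System of length $\ell$ and width $w$ consists of: mutually vertex-disjoint connected subgraphs $C_1,\ldots,C_\ell$; for each $i$ disjoint $A_i,B_i\subseteq V(C_i)$ of size $w$, each node-well-linked in $C_i$, with $(A_i,B_i)$ linked in $C_i$; for each $1\le i<\ell$ a set $\mathcal P_i$ of $w$ node-disjoint paths connecting $B_i$ to $A_{i+1}$,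 all paths of $\bigcup\mathcal P_i$ node-disjoint and internally disjoint from $\bigcup_jV(C_j)$; disjoint connected subgraphs $S_1,\ldots,S_\ell$ disjoint from $\bigcup_jV(C_j)$ and $\bigcup_jV(\mathcal P_j)$; for each $i$ a set $Y_i\subseteq V(S_i)$ of $w$ vertices node-well-linked in $S_i$ and a set $X_i\subseteq V(C_i)$ of $w$ vertices disjoint from $A_i\cup B_i$ with $(A_i,X_i)$ linked in $C_i$; and for each $i$ a set $\mathcal Q_i$ of $w$ node-disjoint paths connecting $X_i$ to $Y_i$, all paths in $\bigcup_j\mathcal Q_j$ disjoint from each other and from the paths of $\bigcup_j\mathcal P_j$, and internally disjoint from $\bigcup_j(S_j\cup C_j)$. An $(A,B,Y)$-crossbar of width $\rho$ in a graph consists of $\rho$ pairwise vertex-disjoint paths $\mathcal P^*$ each connecting $A$ to $B$, and for each $P\in\mathcal P^*$ a path $Q_P$ from a vertex of $P$ to a vertex of $Y$, the paths $Q_P$ pairwise vertex-disjoint, with $P\cap Q_{P'}=\emptyset$ for $P\ne P'$ and $P\cap Q_P$ a single vertex which is an endpoint of $Q_P$. The $(g'\times g')$-grid has vertices $v(i,j)$, $1\le i,j\le g'$, with horizontal edges $(v(i,j),v(i,j+1))$ and vertical edges $(v(i,j),v(i+1,j))$. *)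

(* Defs.v *)
From HB Require Import structures.
From mathcomp Require Import all_boot all_order all_algebra.
From mathcomp Require Import all_classical all_reals all_analysis.
Set Implicit Arguments.
Unset Strict Implicit.
Unset Printing Implicit Defensive.
Import Order.TTheory GRing.Theory Num.Theory.

(* Finite simple graphs whose vertices are taken in an ambient finType, so that
   a graph and its subgraphs have the same type. *)
Record graph (T : finType) := Graph {
  vset : {set T};
  edge : rel T;
  edge_sym : symmetric edge;
  edge_irr : irreflexive edge;
  edge_vset : forall x y, edge x y -> x \in vset }.

Section Graphs.
Variable T : finType.
Implicit Types (G H C : graph T) (A B U : {set T}) (p : seq T).

Definition subgraph H G : Prop :=
  vset H \subset vset G /\ subrel (edge H) (edge G).

Definition connected H : Prop :=
  vset H != finset.set0 /\ {in vset H &, forall x y, connect (edge H) x y}.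

Definition max_degree_le G (d : nat) : Prop :=
  forall x, x \in vset G -> #|[set y | edge G x y]| <= d.

(* A path is its nonempty duplicate-free sequence of vertices, oriented from
   its endpoint in A to its endpoint in B; one-vertex paths are allowed. *)
Definition connects H A B p : bool :=
  if p is x :: q then
    [&& x \in A, last x q \in B, all [in vset H] p, path (edge H) x q & uniq p]
  else false.

Definition inner p : seq T := if p is x :: q then behead (belast x q) else [::].

(* A set of k node-disjoint paths is a family of paths indexed by 'I_k. *)
Definition disjoint_paths H A B k (P : 'I_k -> seq T) : Prop :=
  (forall a, connects H A B (P a)) /\
  (forall a b, a != b -> [disjoint P a & P b]).

Definition well_linked C U : Prop :=
  forall U1 U2 : {set T}, U1 \subset U -> U2 \subset U -> [disjoint U1 & U2] ->
  exists P : 'I_(minn #|U1| #|U2|) -> seq T, disjoint_paths C U1 U2 P.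

Definition linked C A B : Prop :=
  forall A1 B1 : {set T}, A1 \subset A -> B1 \subset B ->
  exists P : 'I_(minn #|A1| #|B1|) -> seq T, disjoint_paths C A1 B1 P.

Definition consecutive p : rel T :=
  [rel x y | infix [:: x; y] p || infix [:: y; x] p].

Section AddPaths.
Variables (H : graph T) (k : nat) (Q : 'I_k -> seq T).

Definition add_paths_vset : {set T} :=
  vset H :|: [set x | [exists a, x \in Q a]].

(* The test x != y only matters for sequences with repetitions; it makes the
   union irreflexive for arbitrary Q. *)
Definition add_paths_edge : rel T :=
  [rel x y | edge H x y || (x != y) && [exists a, consecutive (Q a) x y]].

Lemma add_paths_sym : symmetric add_paths_edge.
Proof.
move=> x y; rewrite /add_paths_edge /= edge_sym eq_sym; congr (_ || (_ && _)).
by apply: eq_existsb => a; rewrite /consecutive /= orbC.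
Qed.

Lemma add_paths_irr : irreflexive add_paths_edge.
Proof. by move=> x; rewrite /add_paths_edge /= edge_irr eqxx. Qed.

Lemma add_paths_in x y : add_paths_edge x y -> x \in add_paths_vset.
Proof.
rewrite /add_paths_edge /add_paths_vset /= !inE.
case/orP=> [/edge_vset -> // | /andP[_ /existsP[a xy]]].
apply/orP; right; apply/existsP; exists a.
by case/orP: xy => /mem_infix; apply; rewrite !inE eqxx ?orbT.
Qed.

(* The union of the graph H and of the paths Q. *)
Definition add_paths : graph T :=
  Graph add_paths_sym add_paths_irr add_paths_in.
End AddPaths.

(* The path P a goes from A to B; Q a goes from a vertex of P a to Y. *)
Definition crossbar H A B (Y : {set T}) (rho : nat) : Prop :=
  exists P Q : 'I_rho -> seq T,
  [/\ disjoint_paths H A B P,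
      forall a, exists2 x, connects H [set x] Y (Q a) &
                  [set z | (z \in P a) && (z \in Q a)] = [set x],
      forall a b, a != b -> [disjoint Q a & Q b] &
      forall a b, a != b -> [disjoint P a & Q b]].

(* All families are indexed by nat; only the indices 1..l are meaningful
   (1..l-1 for hP). *)
Record hairy_path_of_sets (G : graph T) (l w : nat) := HairyPathOfSets {
  hC : nat -> graph T;
  hS : nat -> graph T;
  hA : nat -> {set T};
  hB : nat -> {set T};
  hX : nat -> {set T};
  hY : nat -> {set T};
  hP : nat -> 'I_w -> seq T;
  hQ : nat -> 'I_w -> seq T;

  hC_sub : forall i, 1 <= i <= l -> subgraph (hC i) G /\ connected (hC i);
  hC_disj : forall i j, 1 <= i <= l -> 1 <= j <= l -> i != j ->
    [disjoint vset (hC i) & vset (hC j)];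

  hA_sub : forall i, 1 <= i <= l -> hA i \subset vset (hC i) /\ #|hA i| = w;
  hB_sub : forall i, 1 <= i <= l -> hB i \subset vset (hC i) /\ #|hB i| = w;
  hAB_disj : forall i, 1 <= i <= l -> [disjoint hA i & hB i];
  hA_wl : forall i, 1 <= i <= l -> well_linked (hC i) (hA i);
  hB_wl : forall i, 1 <= i <= l -> well_linked (hC i) (hB i);
  hAB_linked : forall i, 1 <= i <= l -> linked (hC i) (hA i) (hB i);

  hP_conn : forall i, 1 <= i < l -> forall a,
    connects G (hB i) (hA i.+1) (hP i a);
  hP_disj : forall i j (a b : 'I_w), 1 <= i < l -> 1 <= j < l ->
    (i, a) != (j, b) -> [disjoint hP i a & hP j b];
  hP_inner : forall i j a, 1 <= i < l -> 1 <= j <= l ->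
    [disjoint inner (hP i a) & vset (hC j)];

  hS_sub : forall i, 1 <= i <= l -> subgraph (hS i) G /\ connected (hS i);
  hS_disj : forall i j, 1 <= i <= l -> 1 <= j <= l -> i != j ->
    [disjoint vset (hS i) & vset (hS j)];
  hSC_disj : forall i j, 1 <= i <= l -> 1 <= j <= l ->
    [disjoint vset (hS i) & vset (hC j)];
  hSP_disj : forall i j a, 1 <= i <= l -> 1 <= j < l ->
    [disjoint vset (hS i) & hP j a];

  hY_sub : forall i, 1 <= i <= l -> hY i \subset vset (hS i) /\ #|hY i| = w;
  hY_wl : forall i, 1 <= i <= l -> well_linked (hS i) (hY i);
  hX_sub : forall i, 1 <= i <= l -> hX i \subset vset (hC i) /\ #|hX i| = w;
  hX_disj : forall i, 1 <= i <= l -> [disjoint hX i & hA i :|: hB i];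
  hAX_linked : forall i, 1 <= i <= l -> linked (hC i) (hA i) (hX i);

  hQ_conn : forall i, 1 <= i <= l -> forall a,
    connects G (hX i) (hY i) (hQ i a);
  hQ_disj : forall i j (a b : 'I_w), 1 <= i <= l -> 1 <= j <= l ->
    (i, a) != (j, b) -> [disjoint hQ i a & hQ j b];
  hQP_disj : forall i j a b, 1 <= i <= l -> 1 <= j < l ->
    [disjoint hQ i a & hP j b];
  hQ_inner : forall i j a, 1 <= i <= l -> 1 <= j <= l ->
    [disjoint inner (hQ i a) & vset (hS j) :|: vset (hC j)] }.

End Graphs.

(* F maps every vertex of H to its (connected) branch subgraph of G. *)
Definition minor (S T : finType) (H : graph S) (G : graph T) : Prop :=
  exists F : S -> graph T,
  [/\ forall u, u \in vset H -> subgraph (F u) G /\ connected (F u),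
      forall u v, u \in vset H -> v \in vset H -> u != v ->
        [disjoint vset (F u) & vset (F v)] &
      forall u v, edge H u v ->
        exists x y, [/\ x \in vset (F u), y \in vset (F v) & edge G x y]].

Section Grid.
Variable n : nat.

Definition succ_or_pred (i j : 'I_n) : bool := (i.+1 == j) || (j.+1 == i).

Lemma succ_or_pred_sym : symmetric succ_or_pred.
Proof. by move=> i j; rewrite /succ_or_pred orbC. Qed.

Definition grid_edge : rel ('I_n * 'I_n) :=
  [rel u v | (u.1 == v.1) && succ_or_pred u.2 v.2
          || (u.2 == v.2) && succ_or_pred u.1 v.1].

Lemma grid_sym : symmetric grid_edge.
Proof.
move=> u v; rewrite /grid_edge /= (eq_sym u.1) (eq_sym u.2).
by rewrite (succ_or_pred_sym u.1) (succ_or_pred_sym u.2).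
Qed.

Lemma grid_irr : irreflexive grid_edge.
Proof.
by move=> u; rewrite /grid_edge /succ_or_pred /= !eqxx !(gtn_eqF (ltnSn _)).
Qed.

Lemma grid_in u v : grid_edge u v -> u \in [set: 'I_n * 'I_n].
Proof. by rewrite inE. Qed.

Definition grid : graph ('I_n * 'I_n)%type := Graph grid_sym grid_irr grid_in.
End Grid.

Definition log2 (R : realType) (x : R) : R := (ln x / ln 2)%R.

(* Main.v *)
Require Import Defs.
From HB Require Import structures.
From mathcomp Require Import all_boot all_order all_algebra.
From mathcomp Require Import all_classical all_reals all_analysis.
From mathcomp Require Import fintype finset zify ring lra.
Set Implicit Arguments.
Unset Strict Implicit.
Unset Printing Implicit Defensive.
Import Order.TTheory GRing.Theory Num.Theory.

(* The crossbars of the odd clusters, joined through the even clusters, give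
   N = g^2 disjoint rows, each with a hair ending in every odd S_i.  Given any
   two disjoint sets A, B of rows, well-linkedness of Y_i routes a matching
   between A and B inside S_i, so contracting the rows plays the cut-matching
   game.  As long as the union of the matchings has a balanced separation (A, B)
   with a small separator, matching A to B in the next odd cluster raises the
   entropy of the associated averaging process by at least N / 9, and
   the entropy is at most N ln N.  So after O(log g) clusters no such separation
   is left.  A graph on N vertices without balanced separators of size
   N / O(log N) contains every graph of bounded degree on N / O(log^3 N) vertices
   as a minor: branch sets are grown greedily as stars of shortest paths of length
   O(log^2 N), and every obstruction to growing them is moved to a trash set with
   small boundary, which therefore never exceeds N / 4 vertices. *)

(** * Minors of graphs without small balanced separations *)

(** The exponent 1.5 comes from three logarithmic factors. Write g = 2^k and N = 4^k. A cut (A, B)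
    yields entropy only if little load has crossed it before; a separator of s vertices lets each
    earlier matching carry at most s units across, so 25k rounds force s to be of order N/k. The
    trash has boundary at most 1/q of its size, and this boundary together with all branch sets must
    fit into one separator, so q is of order k. Sets with vertex expansion 1/q have diameter of
    order q log N, so a branch set has r of order k^2 vertices. The n^2 branch sets of the grid fit
    if n^2 r is at most of order N/k, that is, for n of order 2^k / k^1.5. The linkage through an
    even cluster cannot be prescribed and permutes the rows. These permutations are fixed before the
    game starts, so a relabelling removes them and the game sees a single set of rows. *)

Lemma card_bigcup_leq (I T : finType) (D : {set I}) (F : I -> {set T}) r :
  {in D, forall i, #|F i| <= r} -> #|\bigcup_(i in D) F i| <= #|D| * r.
Proof.
move=> Fr; rewrite -sum_nat_const.
elim/big_rec2: _ => [|i n U iD leUn]; first by rewrite cards0.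
by apply: leq_trans (leq_card_setU _ _).1 _; apply: leq_add; rewrite ?Fr.
Qed.

Lemma disjointsU (T : finType) (A B C : {set T}) :
  [disjoint A :|: B & C] = [disjoint A & C] && [disjoint B & C].
Proof. by rewrite !disjoints_subset subUset. Qed.

(** * Connectivity inside vertex sets *)

Section Conn.
Variables (V : finType) (e : rel V).
Hypothesis e_sym : symmetric e.
Implicit Types Z : {set V}.

Definition within Z : rel V := [rel x y | [&& x \in Z, y \in Z & e x y]].

(** The empty set counts as connected; this is convenient for rows that take no part in a matching.
    Nonemptiness is asked separately where it matters. *)
Definition conn Z : Prop := {in Z &, forall x y, connect (within Z) x y}.

Lemma within_sym Z : symmetric (within Z).
Proof. by move=> x y; rewrite /within /= e_sym andbCA. Qed.

Lemma sub_connect_within Z1 Z2 : Z1 \subset Z2 ->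
  subrel (connect (within Z1)) (connect (within Z2)).
Proof.
move=> sZ; apply: connect_sub => x y /and3P[xZ yZ exy].
by apply: connect1; rewrite /within /= !(subsetP sZ).
Qed.

Lemma conn1 x : conn [set x].
Proof. by move=> y z /set1P-> /set1P->; apply: connect0. Qed.

Lemma connU Z1 Z2 x y : conn Z1 -> conn Z2 -> x \in Z1 -> y \in Z2 ->
  (x == y) || e x y -> conn (Z1 :|: Z2).
Proof.
move=> c1 c2 x1 y2 xy.
have s1 := sub_connect_within (subsetUl Z1 Z2).
have s2 := sub_connect_within (subsetUr Z1 Z2).
have cS := sym_connect_sym (within_sym (Z1 :|: Z2)).
have cxy : connect (within (Z1 :|: Z2)) x y.
  case/orP: xy => [/eqP-> | exy]; first exact: connect0.
  by apply: connect1; rewrite /within /= !inE x1 y2 exy orbT.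
have cx u : u \in Z1 :|: Z2 -> connect (within (Z1 :|: Z2)) x u.
  case/setUP=> [u1 | u2]; first exact/s1/c1.
  by apply: connect_trans cxy _; apply/s2/c2.
move=> u v uZ vZ; apply: connect_trans (cx v vZ).
by rewrite cS; apply: cx.
Qed.

Lemma conn_path x q : path e x q -> conn [set z in x :: q].
Proof.
elim: q x => [|y q IH] x /=.
  move=> _; have -> : [set z in [:: x]] = [set x] by apply/setP=> z; rewrite !inE.
  exact: conn1.
case/andP=> exy /IH cq.
have -> : [set z in [:: x, y & q]] = [set x] :|: [set z in y :: q].
  by apply/setP=> z; rewrite !inE.
by apply: (connU (x := x) (y := y) (@conn1 x) cq); rewrite ?inE ?eqxx ?exy ?orbT.
Qed.

Lemma connW Z x : x \in Z -> (forall y, y \in Z -> connect (within Z) x y) -> conn Z.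
Proof.
move=> xZ cx u v uZ vZ; apply: connect_trans (cx v vZ).
by rewrite (sym_connect_sym (within_sym Z)); apply: cx.
Qed.

Lemma conn_bigcup (I : finType) (f : rel I) (D : {set I}) (F : I -> {set V}) :
    {in D &, forall i j, connect [rel i j | [&& i \in D, j \in D & f i j]] i j} ->
    {in D, forall i, conn (F i)} ->
    {in D &, forall i j, f i j -> exists x y, [/\ x \in F i, y \in F j & e x y]} ->
  conn (\bigcup_(i in D) F i).
Proof.
move=> cD cF fF; set Z := \bigcup_(i in D) _.
have sF i : i \in D -> F i \subset Z by move=> iD; apply: bigcup_sup.
have link i p : path [rel i j | [&& i \in D, j \in D & f i j]] i p ->
   i \in D -> {in F i & F (last i p), forall x y, connect (within Z) x y}.
  elim: p i => [|j p IH] i /=.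
    by move=> _ iD x y xi yi; apply: (sub_connect_within (sF i iD)); apply: (cF i iD).
  case/andP=> /and3P[iD jD fij] jp _ x y xi yl.
  have [u [v [ui vj euv]]] := fF i j iD jD fij.
  apply: (connect_trans (y := u)).
    by apply: (sub_connect_within (sF i iD)); apply: (cF i iD).
  apply: (connect_trans (y := v)); last exact: (IH j jp jD v y vj yl).
  by apply: connect1; rewrite /within /= (subsetP (sF i iD)) // (subsetP (sF j jD)).
move=> x y /bigcupP[i iD xi] /bigcupP[j jD yj].
by have /connectP[p ip jl] := cD i j iD jD; apply: (link i p) => //; rewrite -jl.
Qed.

Definition nbrs Z : {set V} := [set y | [exists x in Z, e x y]].

Lemma nbrsU Z1 Z2 : nbrs (Z1 :|: Z2) = nbrs Z1 :|: nbrs Z2.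
Proof.
apply/setP=> y; rewrite !inE; apply/exists_inP/idP.
  by case=> x /setUP[] xZ exy; apply/orP; [left | right]; apply/exists_inP; exists x.
by case/orP=> /exists_inP[x xZ exy]; exists x => //; rewrite inE xZ ?orbT.
Qed.

End Conn.

(** * Logarithmic diameter of vertex expanders *)

Section Balls.
Variables (V : finType) (e : rel V) (q : nat) (Z : {set V}).
Hypothesis e_sym : symmetric e.
Hypothesis Z_expands : forall W : {set V}, W \subset Z -> W != set0 ->
  2 * #|W| <= #|Z| -> #|W| < q * #|nbrs e W :&: (Z :\: W)|.

Fixpoint ball x j : {set V} :=
  if j is j'.+1 then ball x j' :|: (nbrs e (ball x j') :&: Z) else [set x].

Lemma ball_sub x j : x \in Z -> ball x j \subset Z.
Proof.
move=> xZ; elim: j => [|j IH] /=; first by rewrite sub1set.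
by rewrite subUset IH subsetIr.
Qed.

Lemma ball_mono x i j : i <= j -> ball x i \subset ball x j.
Proof.
move/subnK=> <-; elim: (j - i) => [//|k IH].
by rewrite addSn /=; apply: subset_trans IH (subsetUl _ _).
Qed.

Lemma ball_center x j : x \in ball x j.
Proof. by rewrite -sub1set; apply: (ball_mono x (leq0n j)). Qed.

Lemma ball_conn x j y : x \in Z -> y \in ball x j -> exists W : {set V},
  [/\ W \subset Z, conn e W, x \in W, y \in W & #|W| <= j.+1].
Proof.
move=> xZ; elim: j y => [|j IH] y /=.
  move/set1P->; exists [set x].
  by split; rewrite ?sub1set ?set11 ?cards1 //; apply: conn1.
case/setUP=> [/IH[W [sW cW xW yW cardW]] | ].
  by exists W; split=> //; apply: leqW.
case/setIP; rewrite inE => /exists_inP[z /IH[W [sW cW xW zW cardW]] ezy] yZ.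
exists (y |: W); split.
- by rewrite subUset sub1set yZ.
- by rewrite setUC; apply: (connU e_sym cW (@conn1 _ _ y) zW (set11 y)); rewrite ezy orbT.
- by rewrite inE xW orbT.
- by rewrite setU11.
- by apply: leq_trans (leq_add (leq_b1 _) cardW) => //; rewrite cardsU1.
Qed.

(** While the ball holds at most half of [Z], each step adds more than 1/q of its size, hence more
    than 1/q of the fixed ball of radius [j]. Growth is stated linearly in [i], so that no real
    exponentials are needed. *)
Lemma ball_grow x j i : x \in Z ->
  (#|Z| < 2 * #|ball x (j + i)|) || ((q + i) * #|ball x j| <= q * #|ball x (j + i)|).
Proof.
move=> xZ; elim: i => [|i IH]; first by rewrite !addn0 leqnn orbT.
have sB : ball x (j + i) \subset ball x (j + i.+1) by apply: ball_mono; lia.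
have cB := subset_leq_card sB.
case/orP: IH => [big | IH]; first by apply/orP; left; lia.
have [big | small] := ltnP #|Z| (2 * #|ball x (j + i)|).
  by apply/orP; left; lia.
have nz : ball x (j + i) != set0 by apply/set0Pn; exists x; apply: ball_center.
have := Z_expands (ball_sub (j + i) xZ) nz small.
have card_next : #|ball x (j + i.+1)| =
    #|ball x (j + i)| + #|nbrs e (ball x (j + i)) :&: (Z :\: ball x (j + i))|.
  rewrite addnS /= -[in RHS]cardsUI.
  set B := ball _ _; set C := nbrs e B.
  have -> : B :&: (C :&: (Z :\: B)) = set0.
    by apply/setP=> z; rewrite !inE; case: (z \in B); rewrite ?andbF.
  rewrite cards0 addn0; apply: eq_card => z; rewrite !inE.
  by case: (z \in B).
have cj : #|ball x j| <= #|ball x (j + i)|.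
  by apply/subset_leq_card/ball_mono; lia.
rewrite card_next => lt; apply/orP; right.
rewrite mulnDr addnS mulSn; lia.
Qed.

(** By linear growth with [i = q], every [q] steps double the ball, until it exceeds half of [Z]. *)
Lemma ball_large x m : 0 < q -> #|Z| <= 2 ^ m -> x \in Z -> #|Z| < 2 * #|ball x (q * m)|.
Proof.
move=> q0 Zm xZ.
have grow j : (#|Z| < 2 * #|ball x (q * j)|) || (2 ^ j <= #|ball x (q * j)|).
  elim: j => [|j IH]; first by rewrite muln0 /= cards1 orbT.
  have sB : #|ball x (q * j)| <= #|ball x (q * j + q)|.
    by apply/subset_leq_card/ball_mono; lia.
  rewrite mulnS addnC; case/orP: IH => [big | IH]; first by apply/orP; left; lia.
  case/orP: (ball_grow (q * j) q xZ) => [-> // | ].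
  rewrite addnn -mul2n mulnAC mulnC leq_pmul2l // => grow.
  by apply/orP; right; rewrite expnS; lia.
have Z0 : 0 < #|Z| by apply/card_gt0P; exists x.
by case/orP: (grow m) => //; lia.
Qed.

(** Two balls that each hold more than half of [Z] intersect; [W] joins the centres through a common
    vertex. *)
Lemma expanding_diameter m x y : 0 < q -> #|Z| <= 2 ^ m -> x \in Z -> y \in Z ->
  exists W : {set V}, [/\ W \subset Z, conn e W, x \in W, y \in W
                        & #|W| <= 2 * (q * m).+1].
Proof.
move=> q0 Zm xZ yZ.
have Bx := ball_large q0 Zm xZ; have By := ball_large q0 Zm yZ.
have /set0Pn[z /setIP[zx zy]] : ball x (q * m) :&: ball y (q * m) != set0.
  apply/negP=> /eqP I0.
  have := cardsUI (ball x (q * m)) (ball y (q * m)); rewrite I0 cards0.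
  have /subset_leq_card : ball x (q * m) :|: ball y (q * m) \subset Z.
    by rewrite subUset !ball_sub.
  lia.
have [W1 [s1 c1 x1 z1 n1]] := ball_conn xZ zx.
have [W2 [s2 c2 y2 z2 n2]] := ball_conn yZ zy.
exists (W1 :|: W2); split; rewrite ?subUset ?s1 ?inE ?x1 ?y2 ?orbT //.
  by apply: (connU e_sym c1 c2 z1 z2); rewrite eqxx.
by have := cardsUI W1 W2; lia.
Qed.

End Balls.

(** * Greedy embedding of a bounded-degree graph *)

Section Embedding.
Variables (V : finType) (e : rel V) (S : finType) (h : rel S).
Hypotheses (e_sym : symmetric e) (h_sym : symmetric h) (h_irr : irreflexive h).

(** The separator is the complement of [A :|: B]; balanced means that each side holds at least a
    quarter of the vertices. *)
Definition no_separation (s : nat) : Prop :=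
  forall A B : {set V}, [disjoint A & B] ->
  {in A & B, forall x y, ~~ e x y} ->
  #|V| <= 4 * #|A| -> #|V| <= 4 * #|B| -> #|A| + #|B| + s < #|V|.

Definition partial_model (D : {set S}) (F : S -> {set V}) : Prop :=
  [/\ {in D, forall u, F u != set0 /\ conn e (F u)},
      {in D &, forall u v, u != v -> [disjoint F u & F v]} &
      {in D &, forall u v, h u v -> exists x y, [/\ x \in F u, y \in F v & e x y]}].

(** Here 1/q is the expansion below which a set is discarded and [r] bounds a branch set: a root and
    at most [d] connected sets leading to its neighbours. Divided by [q], [S_small] says that all
    branch sets and a boundary of |V|/q vertices fit together into a separator of size [s]. *)
Variables (d q m r s : nat).
Hypothesis h_deg : forall u, #|[set v | h u v]| <= d.
Hypothesis e_sep : no_separation s.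
Hypotheses (q_gt0 : 0 < q) (V_small : #|V| <= 2 ^ m).
Hypothesis r_large : 1 + d * (2 * (q * m).+1) <= r.
Hypothesis S_small : q * (#|S| * r) + #|V| <= q * s.
Hypothesis s_small : 8 * s <= #|V|.

(** The set [M] and the rest of the boundary of [U] separate [U] from what remains, and have at most
    [s] vertices. If [U] had between 1/4 and 5/8 of the vertices, the remainder would have at least
    1 - 5/8 - 1/8 = 1/4 of them, a balanced separation. So the trash cannot pass 1/4 unless one step
    carries it beyond 5/8. *)
Lemma trash_small (U M : {set V}) :
  #|M| <= #|S| * r -> 8 * #|U| <= 5 * #|V| ->
  q * #|nbrs e U :&: ~: (U :|: M)| <= #|U| -> 4 * #|U| <= #|V|.
Proof.
move=> Mr U8 dU; rewrite leqNgt; apply/negP=> U4.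
set N := nbrs e U in dU; set B := ~: (U :|: M) :\: N.
have UV : #|U| <= #|V| by apply: max_card.
have Ms : #|M| + #|N :&: ~: (U :|: M)| <= s.
  rewrite -(leq_pmul2l q_gt0) mulnDr; apply: leq_trans S_small.
  by apply: leq_add; rewrite ?leq_pmul2l //; lia.
have cB : #|V| <= #|U| + #|B| + s.
  have := cardsID N (~: (U :|: M)); rewrite -/B setIC.
  have := cardsC (U :|: M); have := cardsUI U M; lia.
have dUB : [disjoint U & B].
  by rewrite disjoints_subset; apply/subsetP=> x; rewrite !inE => ->; rewrite andbF.
have eUB : {in U & B, forall x y, ~~ e x y}.
  move=> x y xU; rewrite inE => /andP[yN _]; apply: contra yN => exy.
  by rewrite inE; apply/exists_inP; exists x.
by have := e_sep dUB eUB; lia.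
Qed.

Definition branches (D : {set S}) (F : S -> {set V}) := \bigcup_(u in D) F u.

(** The invariant of the greedy process: [U] is the trash, [D] the part of the target graph modelled
    so far. The boundary of [U] is counted outside the branch sets only, because these are charged
    to the separator on their own. *)
Definition state (U : {set V}) (D : {set S}) (F : S -> {set V}) : Prop :=
  [/\ partial_model D F, {in D, forall u, #|F u| <= r},
      {in D, forall u, [disjoint U & F u]},
      q * #|nbrs e U :&: ~: (U :|: branches D F)| <= #|U| & 4 * #|U| <= #|V|].

Lemma card_branches (D : {set S}) (F : S -> {set V}) :
  {in D, forall u, #|F u| <= r} -> #|branches D F| <= #|S| * r.
Proof.
move=> Fr; apply: leq_trans (card_bigcup_leq Fr) _.
by rewrite leq_mul2r max_card orbT.
Qed.

Lemma partial_modelS (D D' : {set S}) (F : S -> {set V}) :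
  D' \subset D -> partial_model D F -> partial_model D' F.
Proof.
move=> /subsetP sD [F1 F2 F3]; split.
- by move=> u /sD; apply: F1.
- by move=> u v /sD uD /sD; apply: F2.
- by move=> u v /sD uD /sD; apply: F3.
Qed.

(** A branch set without free neighbours can no longer be linked to new ones. For the same reason
    discarding it adds nothing to the boundary of the trash, and [u] returns to the vertices still
    to be modelled. *)
Lemma state_dump_branch U D F u : state U D F -> u \in D ->
  nbrs e (F u) :&: ~: (U :|: branches D F) = set0 ->
  state (U :|: F u) (D :\ u) F.
Proof.
move=> [mF Fr UF dU U4] uD dF.
have sD : D :\ u \subset D by apply: subsetDl.
have Fr' : {in D :\ u, forall v, #|F v| <= r} by move=> v /(subsetP sD); apply: Fr.
have same : U :|: F u :|: branches (D :\ u) F = U :|: branches D F.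
  by rewrite /branches (big_setD1 u uD) /= setUA.
have dU' : q * #|nbrs e (U :|: F u) :&: ~: (U :|: F u :|: branches (D :\ u) F)|
    <= #|U :|: F u|.
  rewrite same nbrsU setIUl dF setU0; apply: leq_trans dU _.
  exact/subset_leq_card/subsetUl.
split=> //; first exact: partial_modelS mF.
  move=> v /setD1P[vu vD]; case: mF => _ F2 _.
  by rewrite disjointsU ?UF // F2 // eq_sym.
apply: trash_small (card_branches Fr') _ dU'.
have sr : r <= s.
  rewrite -(leq_pmul2l q_gt0); apply: leq_trans S_small.
  apply: leq_trans (leq_addr _ _); rewrite leq_pmul2l // leq_pmull //.
  by apply/card_gt0P; exists u.
have := cardsUI U (F u); have := Fr u uD; lia.
Qed.

(** Both boundaries are at most 1/q of the size of their sets, and sizes add up because [W] is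
    disjoint from [U]. As [W] is at most half of the free vertices, the new trash has at most 1/4 +
    (3/4)/2 = 5/8 of all vertices. *)
Lemma state_dump_set (U : {set V}) (D : {set S}) (F : S -> {set V}) (W : {set V}) :
  state U D F -> W \subset ~: (U :|: branches D F) ->
  2 * #|W| <= #|~: (U :|: branches D F)| ->
  q * #|nbrs e W :&: (~: (U :|: branches D F) :\: W)| <= #|W| ->
  state (U :|: W) D F.
Proof.
move=> [mF Fr UF dU U4] sW W2 dW.
have UW0 : U :&: W = set0.
  apply/setP=> x; rewrite !inE; apply/negP=> /andP[xU xW].
  by have := subsetP sW x xW; rewrite !inE xU.
have cU := cardsUI U W; rewrite UW0 cards0 addn0 in cU.
have dU' : q * #|nbrs e (U :|: W) :&: ~: (U :|: W :|: branches D F)| <= #|U :|: W|.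
  rewrite cU; apply: leq_trans (leq_add dU dW).
  rewrite -mulnDr leq_mul2l; apply/orP; right.
  set X := nbrs e U :&: _; set Y := nbrs e W :&: _.
  apply: leq_trans (_ : #|X :|: Y| <= _); last by have := cardsUI X Y; lia.
  apply: subset_leq_card; apply/subsetP=> x; rewrite nbrsU !in_setI !in_setU !in_setC.
  rewrite !in_setI !in_setD !in_setC !in_setU !negb_or.
  by case/andP=> /orP[]-> /andP[/andP[-> ->] ->]; rewrite ?orbT.
split=> //.
  move=> u uD; rewrite disjointsU ?UF // disjoints_subset.
  apply: subset_trans sW _; rewrite setCS; apply: subset_trans (subsetUr _ _).
  exact: bigcup_sup.
apply: trash_small (card_branches Fr) _ dU'.
have := subset_leq_card (subsetUl U (branches D F)).
have := cardsC (U :|: branches D F); lia.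
Qed.

Lemma conn_star (I : finType) (A : {set I}) (W : I -> {set V}) x :
  {in A, forall i, conn e (W i) /\ x \in W i} -> conn e (x |: \bigcup_(i in A) W i).
Proof.
move=> cW; apply: (connW (x := x) e_sym); first by rewrite setU11.
move=> y; rewrite 2!inE => /orP[/eqP-> | /bigcupP[i iA yi]]; first exact: connect0.
have [ci xi] := cW i iA.
apply: (@sub_connect_within _ _ (W i)); last exact: ci.
by apply: subset_trans (subsetUr _ _); apply: bigcup_sup.
Qed.

(** Any free vertex can serve as the root of the new branch set: the free part expands, so short
    connected sets lead from the root to a free neighbour of each branch set. The trash stays the
    same and the free part shrinks, so the boundary bound survives. *)
Lemma state_extend U D F v : state U D F -> v \notin D ->
  {in D, forall u, nbrs e (F u) :&: ~: (U :|: branches D F) != set0} ->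
  (forall W : {set V}, W \subset ~: (U :|: branches D F) -> W != set0 ->
     2 * #|W| <= #|~: (U :|: branches D F)| ->
     #|W| < q * #|nbrs e W :&: (~: (U :|: branches D F) :\: W)|) ->
  exists F', state U (v |: D) F'.
Proof.
move=> [mF Fr UF dU U4] vD nF; set Z := ~: _ => expZ.
have Z0 : Z != set0.
  rewrite -card_gt0; have := card_branches Fr; have := cardsC (U :|: branches D F).
  have := cardsUI U (branches D F); rewrite -/Z.
  have : #|S| * r <= s.
    by rewrite -(leq_pmul2l q_gt0); apply: leq_trans S_small; apply: leq_addr.
  have : 0 < #|V|.
    rewrite lt0n; apply/negP=> /eqP V0.
    by have := @e_sep set0 set0; rewrite disjoints_subset sub0set V0 cards0 => H;
      have := H isT (fun x y (xs : x \in set0) => ltac:(by rewrite inE in xs)) isT isT.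
  lia.
case/set0Pn: Z0 => x xZ.
(* [W u] contains the root and a free neighbour of [F u]; for [u] outside [D] its value is
   irrelevant. *)
have /fin_all_exists[W WP] u : exists W : {set V}, u \in D -> [/\ W \subset Z, conn e W, x \in W,
    W :&: nbrs e (F u) != set0 & #|W| <= 2 * (q * m).+1].
  have [uD | _] := boolP (u \in D); last by exists set0.
  have /set0Pn[y /setIP[yF yZ]] := nF u uD.
  have Zm : #|Z| <= 2 ^ m by apply: leq_trans (max_card _) V_small.
  have [W [sW cW xW yW nW]] := expanding_diameter e_sym expZ q_gt0 Zm xZ yZ.
  by exists W => _; split=> //; apply/set0Pn; exists y; rewrite inE yW.
pose A := [set u in D | h v u].
have AD u : u \in A -> u \in D by rewrite inE => /andP[].
pose Fv := x |: \bigcup_(u in A) W u.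
pose F' u := if u == v then Fv else F u.
have F'D u : u \in D -> F' u = F u.
  by rewrite /F'; case: eqP => // -> vD'; rewrite vD' in vD.
have F'v : F' v = Fv by rewrite /F' eqxx.
have sFv : Fv \subset Z.
  rewrite subUset sub1set xZ; apply/bigcupsP=> u /AD uD.
  by case: (WP u uD).
have bF' : branches (v |: D) F' = Fv :|: branches D F.
  rewrite /branches big_setU1 //= F'v; congr (_ :|: _).
  by apply: eq_bigr => u; apply: F'D.
have disFv u : u \in D -> [disjoint Fv & F u].
  move=> uD; rewrite disjoints_subset; apply: subset_trans sFv _.
  by rewrite setCS; apply: subset_trans (subsetUr _ _); apply: bigcup_sup.
have adjFv u : u \in D -> h v u -> exists y z, [/\ y \in Fv, z \in F u & e y z].
  move=> uD hvu; have [_ _ _ /set0Pn[y /setIP[yW yN]] _] := WP u uD.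
  move: yN; rewrite inE => /exists_inP[z zF ezy]; exists y, z; split=> //.
    by rewrite inE; apply/orP; right; apply/bigcupP; exists u; rewrite // inE uD.
  by rewrite e_sym.
case: mF => F1 F2 F3.
exists F'; split=> //.
- split.
  + move=> u /setU1P[-> | uD]; last by rewrite F'D //; apply: F1.
    rewrite F'v; split; first by apply/set0Pn; exists x; rewrite setU11.
    by apply: conn_star => u0 /AD /WP[].
  + move=> u w /setU1P[-> | uD] /setU1P[-> | wD]; rewrite ?eqxx // ?F'v ?F'D //.
    * by move=> _; apply: disFv.
    * by move=> _; rewrite disjoint_sym; apply: disFv.
    * exact: F2.
  + move=> u w /setU1P[-> | uD] /setU1P[-> | wD]; rewrite ?h_irr // ?F'v ?F'D //.
    * exact: adjFv.
    * rewrite h_sym => /(adjFv u uD)[y [z [yF zF eyz]]].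
      by exists z, y; rewrite e_sym.
    * exact: F3.
- move=> u /setU1P[-> | uD]; last by rewrite F'D //; apply: Fr.
  rewrite F'v; apply: leq_trans r_large; apply: leq_trans (leq_card_setU _ _).1 _.
  rewrite cards1 leq_add2l.
  apply: leq_trans (card_bigcup_leq (r := 2 * (q * m).+1) _) _.
    by move=> w /AD /WP[].
  rewrite leq_mul2r; apply/orP; right; apply: leq_trans (h_deg v).
  by apply: subset_leq_card; apply/subsetP=> w; rewrite !inE => /andP[].
- move=> u /setU1P[-> | uD]; last by rewrite F'D //; apply: UF.
  rewrite F'v disjoint_sym disjoints_subset; apply: subset_trans sFv _.
  by rewrite setCS subsetUl.
- rewrite bF'; apply: leq_trans dU; rewrite leq_mul2l; apply/orP; right.
  apply: subset_leq_card; apply: setIS; rewrite setCS; apply: setUS.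
  exact: subsetUr.
Qed.

(** Every step either enlarges the trash, possibly losing a branch set, or keeps the trash and adds
    a branch set. This lexicographic descent is encoded in one number, with weight [#|S|.+1] because
    [#|~: D|] is at most [#|S|]. *)
Theorem minor_of_no_separation : exists F : S -> {set V}, partial_model setT F.
Proof.
suff H n U D F : #|~: U| * #|S|.+1 + #|~: D| <= n -> state U D F ->
    exists F', partial_model setT F'.
  apply: (H _ set0 set0 (fun=> set0) (leqnn _)); split.
  - by split=> u; rewrite ?inE // => v; rewrite inE.
  - by move=> u; rewrite inE.
  - by move=> u; rewrite inE.
  - rewrite cards0 (_ : nbrs e set0 = set0) ?set0I ?cards0 ?muln0 //.
    by apply/setP=> y; rewrite !inE; apply/exists_inP=> -[x]; rewrite inE.
  - by rewrite cards0.
elim: n U D F => [|n IH] U D F leq_n st; have [D1 | DT] := eqVneq D setT.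
- by exists F; rewrite -D1; case: st.
- have : 0 < #|~: D| by rewrite card_gt0; apply: contra DT => /eqP D0; rewrite -[D]setCK D0 setC0.
  lia.
- by exists F; rewrite -D1; case: st.
have grow_trash (W : {set V}) (D' : {set S}) : W != set0 -> W \subset ~: U ->
    #|~: (U :|: W)| * #|S|.+1 + #|~: D'| <= n.
  move=> W0 sW; have cW : 0 < #|W| by rewrite card_gt0.
  have UW : #|U :|: W| = #|U| + #|W|.
    by apply/eqP; rewrite (leq_card_setU U W).2 disjoint_sym disjoints_subset.
  have := cardsC U; have := cardsC (U :|: W).
  have c1 : #|~: D'| <= #|S| by apply: max_card.
  rewrite UW => c2 c3; move: leq_n.
  have -> : #|~: U| = #|~: (U :|: W)| + #|W| by lia.
  rewrite mulnDl; have := leq_pmull #|S|.+1 cW. lia.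
set Z := ~: (U :|: branches D F).
have [/exists_inP[u uD /eqP dF] | nF] :=
    boolP [exists u in D, nbrs e (F u) :&: Z == set0].
  apply: IH (state_dump_branch st uD dF).
  case: st => [[F1 _ _] _ UF _ _]; apply: grow_trash; first by case: (F1 u uD).
  by rewrite -disjoints_subset disjoint_sym UF.
have [/existsP[W /and4P[sW W0 W2 dW]] | expZ] := boolP [exists W : {set V},
    [&& W \subset Z, W != set0, 2 * #|W| <= #|Z| & q * #|nbrs e W :&: (Z :\: W)| <= #|W|]].
  apply: IH (state_dump_set st sW W2 dW).
  by apply: grow_trash W0 _; apply: subset_trans sW _; rewrite setCS subsetUl.
have [v vD] : exists v, v \notin D.
  have /subsetPn[v _ vD] : ~~ (setT \subset D) by rewrite subTset.
  by exists v.
have [||F' st'] := state_extend st vD.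
- by move=> u uD; apply: contra nF => dF; apply/exists_inP; exists u.
- move=> W sW W0 W2; rewrite ltnNge; apply: contra expZ => dW.
  by apply/existsP; exists W; rewrite sW W0 W2.
apply: IH st'; move: leq_n.
have := cardsC D; have := cardsC (v |: D); rewrite cardsU1 vD; lia.
Qed.

End Embedding.

(** * The cut-matching game *)

Section Entropy.
Local Open Scope ring_scope.
Variable R : realType.
Implicit Types x y a : R.

(** The factor [x] gives the convention 0 ln 0 = 0 whatever the value of [ln] at 0. *)
Definition xlnx x : R := x * ln x.

(** Convexity: the left side is the tangent of x ln x at [a]. It is [x] times the inequality ln
    (a/x) <= a/x - 1. *)
Lemma xlnx_tangent x a : 0 <= x -> 0 < a -> x * ln a + x - a <= xlnx x.
Proof.
rewrite le_eqVlt => /orP[/eqP <- | x0] a0; first by rewrite /xlnx !mul0r !add0r; lra.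
have ax0 : 0 < a / x by apply: divr_gt0.
have : ln (1 + (a / x - 1)) <= a / x - 1 by apply: le_ln1Dx; lra.
rewrite addrC subrK ln_div ?posrE // => H.
have : x * (ln a - ln x) <= x * (a / x - 1) by rewrite ler_pM2l.
rewrite mulrBr mulrBr mulr1 [x * (a / x)]mulrC divfK ?gt_eqF // /xlnx; lra.
Qed.

(** Twice the Jensen gap: the entropy gained when two vertices with loads [x] and [y] of one origin
    both pass to the mean. *)
Definition xlnx_gap x y : R := xlnx x + xlnx y - 2 * xlnx ((x + y) / 2).

Lemma xlnx_gapC x y : xlnx_gap x y = xlnx_gap y x.
Proof. by rewrite /xlnx_gap [x + y]addrC; lra. Qed.

Lemma xlnx_gap_ge0 x y : 0 <= x -> 0 <= y -> 0 <= xlnx_gap x y.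
Proof.
move=> x0 y0; have [/eqP | m0] := eqVneq (x + y) 0.
  rewrite paddr_eq0 // => /andP[/eqP-> /eqP->].
  by rewrite /xlnx_gap /xlnx !(mul0r, addr0, mulr0) subrr.
have {}m0 : 0 < (x + y) / 2 by rewrite divr_gt0 // lt_neqAle eq_sym m0 addr_ge0.
have Hx := xlnx_tangent x0 m0; have Hy := xlnx_tangent y0 m0.
rewrite /xlnx_gap [xlnx ((x + y) / 2)]/xlnx; lra.
Qed.

(* The tangent plane of the 1-homogeneous convex function xlnx_gap at (3, 1). *)
Lemma xlnx_gap_ge x y : 0 <= x -> 0 <= y -> x / 3 - y <= xlnx_gap x y.
Proof.
move=> x0 y0; have [/eqP | m0] := eqVneq (x + y) 0.
  rewrite paddr_eq0 // => /andP[/eqP-> /eqP->].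
  by rewrite /xlnx_gap /xlnx !(mul0r, addr0, mulr0).
have {}m0 : 0 < (x + y) / 2 by rewrite divr_gt0 // lt_neqAle eq_sym m0 addr_ge0.
have Em : x + y = 2 * ((x + y) / 2) by field.
rewrite /xlnx_gap; move: ((x + y) / 2) m0 Em => z z0 Em.
have a0 : 0 < 3 / 2 :> R by lra.
have b0 : 0 < 1 / 2 :> R by lra.
(* Tangents at 3z/2 and z/2, where the mean is [z] and the ratio is 3 : 1. Since x + y = 2z, all
   terms in [z] cancel against 2 z ln z, and only x ln (3/2) + y ln (1/2) remains. *)
have := xlnx_tangent x0 (mulr_gt0 z0 a0); have := xlnx_tangent y0 (mulr_gt0 z0 b0).
rewrite (lnM (x := z) (y := 3 / 2)) ?posrE // (lnM (x := z) (y := 1 / 2)) ?posrE //.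
move=> Hy Hx.
have l32 : 1 / 3 <= ln (3 / 2 : R).
  have : ln (1 + - (1 / 3) : R) <= - (1 / 3) by apply: le_ln1Dx; lra.
  have -> : 1 + - (1 / 3) = (3 / 2)^-1 :> R by field.
  by rewrite lnV ?posrE; lra.
have l12 : -1 <= ln (1 / 2 : R).
  have : ln (1 + 1 : R) <= 1 by apply: le_ln1Dx; lra.
  have -> : 1 / 2 = (1 + 1)^-1 :> R by field.
  by rewrite lnV ?posrE; lra.
have Kx : x * (1 / 3) <= x * ln (3 / 2) by apply: ler_wpM2l.
have Ky : y * -1 <= y * ln (1 / 2) by apply: ler_wpM2l.
have : x * ln z + y * ln z = 2 * (z * ln z) by rewrite -mulrDl Em mulrA.
rewrite [xlnx z]/xlnx; lra.
Qed.

End Entropy.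

(** * Entropy and leakage of the averaging process *)

Section Averaging.
Local Open Scope ring_scope.
Variables (R : realType) (V : finType).
Implicit Types (ss : seq (V -> V)) (sg : V -> V) (A : {set V}).

(* mass ss v i is the share of the unit started at i that sits at v after every
   matched pair of every round has averaged its loads. *)
Fixpoint mass ss (v i : V) : R :=
  if ss is sg :: ss' then (mass ss' v i + mass ss' (sg v) i) / 2 else (v == i)%:R.

Definition entropy ss : R := - \sum_v \sum_i xlnx (mass ss v i).

(** The load at [v] that started on the other side of [A]; it measures how far the earlier rounds
    have already mixed the two sides. *)
Definition leak A ss (v : V) : R :=
  \sum_(i | (i \in A) != (v \in A)) mass ss v i.

Definition crossing A sg : nat := #|[set v in A | sg v \notin A]|.

Lemma mass_ge0 ss v i : 0 <= mass ss v i.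
Proof.
elim: ss v => [|sg ss IH] v /=; first by rewrite ler0n.
by rewrite divr_ge0 // addr_ge0.
Qed.

Lemma mass_sum ss v : \sum_i mass ss v i = 1.
Proof.
elim: ss v => [|sg ss IH] v /=.
  by rewrite (bigD1 v) //= eqxx big1 ?addr0 // => i /negPf iv; rewrite eq_sym iv.
by rewrite -mulr_suml big_split /= !IH -[1 + 1]/(2%:R) divff // pnatr_eq0.
Qed.

Lemma leak_ge0 A ss v : 0 <= leak A ss v.
Proof. by apply: sumr_ge0 => i _; apply: mass_ge0. Qed.

Lemma mass_stay A ss v :
  \sum_(i | (i \in A) == (v \in A)) mass ss v i = 1 - leak A ss v.
Proof.
have := mass_sum ss v; rewrite (bigID (fun i => (i \in A) == (v \in A))) /= => <-.
by rewrite addrK.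
Qed.

(** Gibbs' inequality: for each [v] the loads form a probability distribution, and the tangent at
    1/n bounds its entropy by ln n. *)
Lemma entropy_le ss : (0 < #|V|)%N -> entropy ss <= #|V|%:R * ln #|V|%:R.
Proof.
move=> V0; set n : R := #|V|%:R; have n0 : 0 < n by rewrite ltr0n.
rewrite /entropy lerNl -mulrN /n -[leLHS]mulr1 -mulrA.
suff Hv v : - ln n <= \sum_i xlnx (mass ss v i).
  by rewrite mulr1 mulr_natl -sumr_const; apply: ler_sum => v _; apply: Hv.
apply: (@le_trans _ _ (\sum_i (mass ss v i * ln n^-1 + mass ss v i - n^-1))); last first.
  by apply: ler_sum => i _; apply: xlnx_tangent; rewrite ?mass_ge0 ?invr_gt0.
rewrite sumrB big_split /= -mulr_suml mass_sum sumr_const -mulr_natr mulVf ?gt_eqF //.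
by rewrite lnV ?posrE // mul1r addrK.
Qed.

Lemma entropy0 : entropy [::] = 0.
Proof.
rewrite /entropy big1 ?oppr0 // => v _; rewrite big1 // => i _ /=.
by case: eqP => _; rewrite /xlnx ?ln1 ?mulr0 ?mul0r.
Qed.

Lemma sum_involutive sg (F : V -> R) : involutive sg ->
  \sum_v F (sg v) = \sum_v F v.
Proof. by move=> sgK; rewrite [RHS](reindex_inj (inv_inj sgK)). Qed.

Lemma sum_crossing A sg : involutive sg ->
  \sum_v ((v \in A) != (sg v \in A))%:R = 2 * (crossing A sg)%:R :> R.
Proof.
move=> sgK; pose f v : R := ((v \in A) && (sg v \notin A))%:R.
have -> : \sum_v ((v \in A) != (sg v \in A))%:R = \sum_v (f v + f (sg v)).
  apply: eq_bigr => v _; rewrite /f sgK.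
  by case: (v \in A); case: (sg v \in A); rewrite /= ?addr0 ?add0r.
rewrite big_split /= (sum_involutive f sgK) /=.
have -> : \sum_v f v = (crossing A sg)%:R; last by rewrite mulr_natl.
rewrite /crossing -sum1_card natr_sum [RHS]big_mkcond /=; apply: eq_bigr => v _.
by rewrite inE /f; case: ifP.
Qed.

(** Partners on the same side average their leaks. If they lie on opposite sides, the load of the
    partner that is foreign to [v] is at most its whole load, which is 1. *)
Lemma leak_cons A ss sg v : leak A (sg :: ss) v <=
  (leak A ss v + leak A ss (sg v) + ((v \in A) != (sg v \in A))%:R) / 2.
Proof.
rewrite {1}/leak /= -mulr_suml ler_pM2r ?invr_gt0 // big_split /= -/(leak A ss v).
rewrite -addrA lerD2l; have [-> | neq] /= := eqVneq (v \in A) (sg v \in A).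
  by rewrite addr0.
apply: le_trans (_ : 1 <= _); last by rewrite lerDr leak_ge0.
rewrite -(mass_sum ss (sg v)) [leRHS](bigID (fun i => (i \in A) != (v \in A))) /=.
by rewrite lerDl; apply: sumr_ge0 => i _; apply: mass_ge0.
Qed.

Lemma total_leak_cons A ss sg : involutive sg ->
  \sum_v leak A (sg :: ss) v <= \sum_v leak A ss v + (crossing A sg)%:R.
Proof.
move=> sgK; apply: (@le_trans _ _ (\sum_v (leak A ss v + leak A ss (sg v) +
    ((v \in A) != (sg v \in A))%:R) / 2)).
  by apply: ler_sum => v _; apply: leak_cons.
rewrite -mulr_suml !big_split /= sum_crossing //.
rewrite (sum_involutive (leak A ss) sgK) /=; lra.
Qed.

Lemma total_leak_nil A : \sum_v leak A [::] v = 0.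
Proof.
rewrite big1 // => v _; rewrite /leak big1 // => i /=.
by case: (eqVneq v i) => [-> | //]; rewrite eqxx.
Qed.

Lemma gap_sum_ge0 ss v w : 0 <= \sum_i xlnx_gap (mass ss v i) (mass ss w i).
Proof. by apply: sumr_ge0 => i _; apply: xlnx_gap_ge0; apply: mass_ge0. Qed.

(* Loads on opposite sides of A have almost disjoint supports if little has
   leaked, so averaging them produces entropy. *)
Lemma gap_sum_crossing A ss v w : (v \in A) != (w \in A) ->
  2 / 3 - 4 / 3 * (leak A ss v + leak A ss w)
    <= \sum_i xlnx_gap (mass ss v i) (mass ss w i).
Proof.
move=> vw; pose P i := (i \in A) == (v \in A).
have Pw i : ((i \in A) == (w \in A)) = ~~ P i.
  by move: vw; rewrite /P; case: (i \in A); case: (v \in A); case: (w \in A).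
have sv := mass_stay A ss v; have sw := mass_stay A ss w.
have lw : leak A ss w = \sum_(i | P i) mass ss w i.
  by apply: eq_bigl => i; rewrite Pw negbK.
rewrite (eq_bigl _ _ Pw) in sw; rewrite [leRHS](bigID P) /=.
(* For origins on the side of [v] the heavy load is at [v], for the others at [w]. The two sums give
   (1 - leak v)/3 - leak w and (1 - leak w)/3 - leak v. *)
have H1 : \sum_(i | P i) (mass ss v i / 3 - mass ss w i) <=
    \sum_(i | P i) xlnx_gap (mass ss v i) (mass ss w i).
  by apply: ler_sum => i _; apply: xlnx_gap_ge; apply: mass_ge0.
have H2 : \sum_(i | ~~ P i) (mass ss w i / 3 - mass ss v i) <=
    \sum_(i | ~~ P i) xlnx_gap (mass ss v i) (mass ss w i).
  by apply: ler_sum => i _; rewrite xlnx_gapC; apply: xlnx_gap_ge; apply: mass_ge0.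
move: H1 H2; rewrite !sumrB -!mulr_suml sv sw -lw -/(leak A ss v); lra.
Qed.

(** Crossing pairs gain by their almost disjoint supports, all other pairs gain at least 0. The sum
    over vertices sees each pair twice, which the factor 1/2 compensates. *)
Lemma entropy_cons A ss sg : involutive sg ->
  entropy ss + (2 / 3) * (crossing A sg)%:R - (4 / 3) * \sum_v leak A ss v
    <= entropy (sg :: ss).
Proof.
move=> sgK.
have E : entropy (sg :: ss) - entropy ss =
    (\sum_v \sum_i xlnx_gap (mass ss v i) (mass ss (sg v) i)) / 2.
  pose h v := \sum_i xlnx (mass ss v i).
  have -> : \sum_v \sum_i xlnx_gap (mass ss v i) (mass ss (sg v) i) =
      \sum_v (h v + h (sg v) - 2 * \sum_i xlnx (mass (sg :: ss) v i)).
    by apply: eq_bigr => v _; rewrite /xlnx_gap sumrB big_split /= mulr_sumr.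
  rewrite sumrB big_split /= (sum_involutive h sgK) /= -mulr_sumr.
  rewrite /entropy /h; lra.
suff : \sum_v (((v \in A) != (sg v \in A))%:R * (2 / 3)
      - 4 / 3 * (leak A ss v + leak A ss (sg v))) <=
    \sum_v \sum_i xlnx_gap (mass ss v i) (mass ss (sg v) i).
  rewrite sumrB -mulr_suml -mulr_sumr big_split /= sum_crossing //.
  rewrite (sum_involutive (leak A ss) sgK) /=; lra.
apply: ler_sum => v _; have [neq | eq] := boolP (_ != _).
  by rewrite mul1r; apply: gap_sum_crossing.
apply: le_trans (gap_sum_ge0 _ _ _); rewrite mul0r.
have := leak_ge0 A ss v; have := leak_ge0 A ss (sg v); lra.
Qed.

End Averaging.

(** * The cut player against an arbitrary matching player *)

Section Game.
Local Open Scope ring_scope.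
Variables (R : realType) (V : finType).
Variables (playable_at : nat -> (V -> V) -> Prop) (L s m : nat).
Hypothesis matching_player : forall t (A B : {set V}), (t < L)%N -> [disjoint A & B] ->
  exists sg, [/\ playable_at t sg, involutive sg &
                 (minn #|A| #|B| <= #|[set v in A | sg v \in B]|)%N].

(** The last round is at the head, so a matching put on top of [ss'] was played in round
    [size ss']. *)
Fixpoint realized (ss : seq (V -> V)) : Prop :=
  if ss is sg :: ss' then [/\ realized ss', playable_at (size ss') sg & involutive sg] else True.

Definition union_edge (ss : seq (V -> V)) : rel V :=
  [rel v w | (v != w) && has (fun sg => sg v == w) ss].

Lemma union_edge_sym ss : realized ss -> symmetric (union_edge ss).
Proof.
move=> rs v w; rewrite /union_edge /= eq_sym; congr (_ && _).
elim: ss rs => //= sg ss IH [/IH-> _ sgK]; congr (_ || _).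
by rewrite (can2_eq sgK sgK) eq_sym.
Qed.

(** A partner outside [A] cannot lie in [B], as the pair would be an edge between [A] and [B]; it
    lies in the separator, and distinct vertices have distinct partners. *)
Lemma crossing_separation ss sg (A B : {set V}) : involutive sg ->
    (forall v, v != sg v -> union_edge ss v (sg v)) ->
    {in A & B, forall v w, ~~ union_edge ss v w} ->
  (crossing A sg <= #|~: (A :|: B)|)%N.
Proof.
move=> sgK sg_edge AB; rewrite /crossing -(card_imset _ (inv_inj sgK)).
apply/subset_leq_card/subsetP => w /imsetP[v]; rewrite inE => /andP[vA swA] ->.
rewrite !inE negb_or swA /=; apply/negP => swB.
have /negP[] := AB v (sg v) vA swB; apply: sg_edge.
by apply: contraNneq swA => <-.
Qed.

Lemma total_leak_separation ss (A B : {set V}) : realized ss ->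
    {in A & B, forall v w, ~~ union_edge ss v w} ->
  \sum_v leak R A ss v <= (size ss * #|~: (A :|: B)|)%:R.
Proof.
elim: ss => [|sg ss IH] /= rs AB; first by rewrite total_leak_nil.
case: rs => rs _ sgK; apply: le_trans (total_leak_cons R A ss sgK) _.
rewrite mulSn addnC natrD lerD //.
  apply: IH => // v w vA wB; apply: contra (AB v w vA wB) => /andP[vw hvw].
  by rewrite /union_edge /= vw hvw orbT.
rewrite ler_nat; apply: (crossing_separation sgK _ AB) => v vsv.
by rewrite /union_edge /= vsv eqxx.
Qed.

Hypothesis V_gt0 : (0 < #|V|)%N.
Hypotheses (V_small : (#|V| <= 2 ^ m)%N) (L_large : (9 * m < L)%N).
Hypothesis s_small : (24 * (L * s) <= #|V|)%N.

(** At least N/4 vertices of [A] are matched into [B], and the total leak is at most L s <= N/24.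
    The gain is thus at least (2/3)(N/4) - (4/3)(N/24) = N/9. *)
Lemma cut_player_step ss : realized ss -> (size ss < L)%N ->
    ~ no_separation (union_edge ss) s ->
  exists sg, realized (sg :: ss) /\ entropy R ss + #|V|%:R / 9 <= entropy R (sg :: ss).
Proof.
move=> rs ssL nsep.
have [A [B [dAB AB A4 B4 Vs]]] : exists A B : {set V}, [/\ [disjoint A & B],
    {in A & B, forall v w, ~~ union_edge ss v w},
    (#|V| <= 4 * #|A|)%N, (#|V| <= 4 * #|B|)%N & (#|V| <= #|A| + #|B| + s)%N].
  apply: contrapT => nAB; apply: nsep => A B dAB AB A4 B4; rewrite ltnNge.
  by apply/negP => Vs; apply: nAB; exists A, B.
have [sg [rsg sgK sgAB]] := matching_player ssL dAB.
exists sg; split=> //; apply: le_trans (entropy_cons R A ss sgK).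
have := total_leak_separation rs AB; set l := \sum_v _ => leak_le.
have cr : (#|V| <= 4 * crossing A sg)%N.
  have : (#|[set v in A | sg v \in B]| <= crossing A sg)%N.
    apply/subset_leq_card/subsetP => v; rewrite !inE => /andP[-> svB].
    by rewrite (disjointFl dAB svB).
  lia.
have out : (#|~: (A :|: B)| <= s)%N.
  have := cardsC (A :|: B); have := (leq_card_setU A B).2; rewrite dAB => /eqP->.
  lia.
have le24 : (24 * (size ss * #|~: (A :|: B)|) <= #|V|)%N.
  apply: leq_trans s_small; rewrite leq_mul2l /=; apply: leq_mul => //; exact: ltnW.
move: cr le24; rewrite -!(ler_nat R) !natrM; lra.
Qed.

Lemma cut_player_wins : exists ss : seq (V -> V),
  [/\ realized ss, (size ss <= L)%N & no_separation (union_edge ss) s].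
Proof.
apply: contrapT => nwin.
have [ss [rs ssL ent]] : exists ss : seq (V -> V), [/\ realized ss, size ss = L
    & #|V|%:R / 9 * (size ss)%:R <= entropy R ss].
  have : (L <= L)%N by []. 
  (* The generalised occurrences count the rounds played; the remaining one is the fixed bound. *)
  elim: {1 3}L => [_|t IH tL].
    by exists [::]; rewrite entropy0 mulr0.
  have [ss [rs sst ent]] := IH (ltnW tL).
  have [||sg [rsg ent']] := cut_player_step rs; first by rewrite sst.
    by move=> nsep; apply: nwin; exists ss; split=> //; rewrite sst ltnW.
  exists (sg :: ss); split=> //; first by rewrite /= sst.
  by rewrite [size _]/= -[(size ss).+1%:R]natr1 mulrDr mulr1; apply: le_trans ent'; rewrite lerD2r.
have n0 : 0 < #|V|%:R :> R by rewrite ltr0n.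
have := le_trans ent (entropy_le R ss V_gt0).
have : ln #|V|%:R <= m%:R :> R.
  apply: le_trans (_ : ln (2 ^+ m) <= _).
    by rewrite ler_ln ?posrE ?exprn_gt0 // -natrX ler_nat.
  have ln2 : ln (1 + 1 : R) <= 1 by apply: le_ln1Dx; lra.
  by rewrite lnXn // -[_ *+ m]mulr_natl -[leRHS]mulr1 ler_wpM2l.
rewrite ssL; move: L_large; rewrite -(ltr_nat R) natrM => L9 lnV.
have : #|V|%:R * ln #|V|%:R <= #|V|%:R * m%:R :> R by rewrite ler_pM2l.
have : #|V|%:R * (9 * m%:R) < #|V|%:R * L%:R :> R by rewrite ltr_pM2l.
lra.
Qed.

End Game.

(** * Rows of a hairy path-of-sets system *)

Section Paths.
Variable T : finType.
Implicit Types (e : rel T) (p q : seq T) (x y z : T) (Z : {set T}).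

Lemma conn_subrel e e' Z : subrel e e' -> conn e Z -> conn e' Z.
Proof.
move=> ee' cZ x y xZ yZ; move: (cZ x y xZ yZ); apply: connect_sub => u v.
by case/and3P=> uZ vZ /ee' euv; apply: connect1; apply/and3P.
Qed.

Lemma infix_path e p x y : infix [:: x; y] p -> sorted e p -> e x y.
Proof.
case/infixP=> p1 [p2 ->]; elim: p1 => [|u p1 IH] /=; first by case/andP.
by move/path_sorted.
Qed.

Lemma infix_inner p x z y : infix [:: z; y] (x :: p) ->
  z = x \/ z \in inner (x :: p).
Proof.
case/infixP=> -[|x' p1] [p2 /= [-> ->]]; first by left.
right; case: p1 => [|u p1]; rewrite /= ?mem_head // belast_cat mem_cat /= !inE.
by rewrite eqxx !orbT.
Qed.

Lemma pred_uniq p x y y' : uniq p -> infix [:: y; x] p -> infix [:: y'; x] p -> y = y'.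
Proof.
have H z : uniq p -> infix [:: z; x] p -> z = nth x p (index x p).-1.
  move=> + /infixP[p1 [p2 Ep]]; rewrite Ep cat_uniq => /and3P[_ /hasPn nx].
  move=> /= /andP[zx _]; rewrite index_cat.
  have /negPf-> : x \notin p1 by apply: nx; rewrite !inE eqxx orbT.
  have /negPf zx' : z != x by apply: contraNneq zx => ->; rewrite mem_head.
  by rewrite /= zx' eqxx addn1 /= nth_cat ltnn subnn.
by move=> up y1 y2; rewrite (H y) // -(H y').
Qed.

Lemma inner_two_neighbours e p x z : symmetric e -> path e x p -> uniq (x :: p) ->
  z \in inner (x :: p) -> exists y1 y2, [/\ y1 != y2, e z y1 & e z y2].
Proof.
move=> e_sym; case: p => [//|y p]; rewrite /inner /=.
elim: p x y => [//|w p IH] x y /=; rewrite inE => /and3P[exy eyw wp] /and4P[]xn yn wn up.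
case/orP=> [/eqP-> | zp].
  exists x, w; rewrite e_sym; split=> //.
  by apply: contraNneq xn => ->; rewrite !inE eqxx orbT.
by apply: (IH y w) => //=; rewrite ?eyw ?yn ?wn.
Qed.

Lemma mem_ends_inner x p z : z \in x :: p -> [\/ z = x, z = last x p | z \in inner (x :: p)].
Proof.
rewrite {1}lastI mem_rcons inE => /orP[/eqP zl | ]; first by apply: Or32.
case: p => [|y p] /=; first by [].
by rewrite inE => /orP[/eqP zx | zp]; [apply: Or31 | apply: Or33].
Qed.

Lemma connects_facts (H : graph T) (A B : {set T}) p : connects H A B p ->
  exists x y, [/\ x \in A /\ x \in p, y \in B /\ y \in p, {subset p <= vset H},
    conn (edge H) [set z in p] & forall z, z \in p -> [\/ z = x, z = y | z \in inner p]].
Proof.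
case: p => [//|x q] /and5P[xA lB /allP sp pq _]; exists x, (last x q); split=> //.
- by rewrite mem_head.
- by rewrite mem_last.
- exact: (conn_path (@edge_sym _ H) pq).
- exact: mem_ends_inner.
Qed.

End Paths.

Section Covering.
Variables (T : finType) (H : graph T) (A B : {set T}) (k : nat) (P : 'I_k -> seq T).
Hypothesis dP : disjoint_paths H A B P.

Lemma ends_injective (f : 'I_k -> T) : (forall a, f a \in P a) -> injective f.
Proof.
move=> fP a b fab; apply: contraTeq (fP a) => /(dP.2) dab.
by rewrite fab (disjointFl dab) ?fP.
Qed.

(** Disjoint paths have distinct ends, so [k] of them exhaust a set of size [k]. This is what lets a
    row continue from any vertex of B_i along some path of P_i. *)
Lemma ends_onto (f : 'I_k -> T) (C : {set T}) : #|C| = k ->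
  (forall a, f a \in P a) -> (forall a, f a \in C) -> forall x, x \in C -> exists a, x = f a.
Proof.
move=> cC fP fC x xC; have inj := ends_injective fP.
have /setP/(_ x) : f @: [set: 'I_k] = C.
  apply/eqP; rewrite eqEcard card_imset // cardsT card_ord cC leqnn andbT.
  by apply/subsetP=> _ /imsetP[a _ ->].
by rewrite xC => /imsetP[a _ ->]; exists a.
Qed.

End Covering.

(** * Disjoint regions, and the part of a row inside an odd cluster *)

Section System.
Variables (T : finType) (G : graph T) (l w N : nat) (H : hairy_path_of_sets G l w).
Implicit Types (i j c t : nat) (x y z : T) (v : 'I_N).

(* Pairwise disjoint regions of the system: c = 0 is a cluster C_i together with
   the paths of Q_i cut off at S_i, c = 1 the interiors of the paths P_i, and
   c = 2 the cluster S_i. *)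
Definition region c i : {set T} :=
  match c with
  | 0 => (vset (hC H i) :|: [set x | [exists a, x \in hQ H i a]]) :\: vset (hS H i)
  | 1 => [set x | [exists a, x \in inner (hP H i a)]]
  | _ => vset (hS H i)
  end.

(** There is no path set after the last cluster, hence the shorter range for [c == 1]. *)
Definition valid_index c i : bool := if c == 1 then 1 <= i < l else (1 <= i <= l) && (c <= 2).

Lemma hX_C i : 1 <= i <= l -> {subset hX H i <= vset (hC H i)}.
Proof. by move=> il; apply/subsetP; case: (hX_sub H il). Qed.

Lemma hY_S i : 1 <= i <= l -> {subset hY H i <= vset (hS H i)}.
Proof. by move=> il; apply/subsetP; case: (hY_sub H il). Qed.

Lemma hA_C i : 1 <= i <= l -> {subset hA H i <= vset (hC H i)}.
Proof. by move=> il; apply/subsetP; case: (hA_sub H il). Qed.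

Lemma hB_C i : 1 <= i <= l -> {subset hB H i <= vset (hC H i)}.
Proof. by move=> il; apply/subsetP; case: (hB_sub H il). Qed.

Lemma notS_of_C i j x : 1 <= i <= l -> 1 <= j <= l -> x \in vset (hC H i) ->
  x \notin vset (hS H j).
Proof. by move=> il jl xC; rewrite (disjointFl (hSC_disj H jl il)). Qed.

Lemma C_sub_region i : 1 <= i <= l -> {subset vset (hC H i) <= region 0 i}.
Proof. by move=> il x xC; rewrite !inE xC (notS_of_C il il xC). Qed.

Lemma hQ_cases i a x : 1 <= i <= l -> x \in hQ H i a ->
  [\/ x \in vset (hC H i), x \in vset (hS H i)
    | forall j, 1 <= j <= l -> x \notin vset (hS H j) :|: vset (hC H j)].
Proof.
move=> il; have [u [v [[uX _] [vY _] _ _ ends]]] := connects_facts (hQ_conn H il a).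
case/ends=> [-> | -> | xin]; first by apply: Or31; apply: hX_C.
  by apply: Or32; apply: hY_S.
by apply: Or33 => j jl; rewrite (disjointFr (hQ_inner H a il jl) xin).
Qed.

Lemma region0_notS i j x : 1 <= i <= l -> 1 <= j <= l -> x \in region 0 i ->
  x \notin vset (hS H j).
Proof.
move=> il jl; rewrite !inE => /andP[xS /orP[xC | /existsP[a xa]]].
  exact: notS_of_C xC.
case: (hQ_cases il xa) => [xC | xS' | /(_ j jl)]; first exact: notS_of_C xC.
  by rewrite xS' in xS.
by rewrite inE negb_or => /andP[].
Qed.

Lemma region0_inj i j x : 1 <= i <= l -> 1 <= j <= l ->
  x \in region 0 i -> x \in region 0 j -> i = j.
Proof.
have HC i' j' a : 1 <= i' <= l -> 1 <= j' <= l -> x \notin vset (hS H i') ->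
    x \in hQ H i' a -> x \in vset (hC H j') -> i' = j'.
  move=> il jl xS xa xC; case: (hQ_cases il xa) => [xC' | xS' | /(_ j' jl)].
  - by apply: contraTeq xC => /(hC_disj H il jl) d; rewrite (disjointFr d).
  - by rewrite xS' in xS.
  - by rewrite inE xC orbT.
move=> il jl; rewrite !inE => /andP[xSi xi] /andP[xSj xj].
case/orP: xi => [xi | /existsP[a xa]]; case/orP: xj => [xj | /existsP[b xb]].
- by apply: contraTeq xj => /(hC_disj H il jl) d; rewrite (disjointFr d).
- by apply/esym/(HC j i b).
- exact: (HC i j a).
- apply: contraTeq xb => ij; have nab : (i, a) != (j, b) by rewrite xpair_eqE (negPf ij).
  by rewrite (disjointFr (hQ_disj H il jl nab)).
Qed.

Lemma region01_disj i j x : 1 <= i <= l -> 1 <= j < l ->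
  x \in region 0 i -> x \notin region 1 j.
Proof.
move=> il jl; rewrite !inE => /andP[_ xi]; apply/existsP=> -[b xb].
case/orP: xi => [xC | /existsP[a xa]].
  by have := disjointFr (hP_inner H b jl il) xb; rewrite xC.
have : x \in hP H j b.
  by case: (hP H j b) xb => [//|u p] /= /mem_behead /mem_belast.
by rewrite (disjointFr (hQP_disj H a b il jl) xa).
Qed.

Lemma inner_sub (p : seq T) : {subset inner p <= p}.
Proof. by case: p => [//|u p] z /= /mem_behead /mem_belast. Qed.

Lemma region1_inj i j x : 1 <= i < l -> 1 <= j < l ->
  x \in region 1 i -> x \in region 1 j -> i = j.
Proof.
move=> il jl; rewrite !inE => /existsP[a /inner_sub xa] /existsP[b /inner_sub xb].
apply: contraTeq xb => ij; have nab : (i, a) != (j, b) by rewrite xpair_eqE (negPf ij).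
by rewrite (disjointFr (hP_disj H il jl nab)).
Qed.

Lemma region12_disj i j x : 1 <= i < l -> 1 <= j <= l ->
  x \in region 1 i -> x \notin vset (hS H j).
Proof.
move=> il jl; rewrite !inE => /existsP[a /inner_sub xa].
by rewrite (disjointFl (hSP_disj H a jl il)).
Qed.

(** A vertex determines its region; disjointness of whole rows thus reduces to disjointness within
    one region. *)
Lemma region_inj c c' i i' x : valid_index c i -> valid_index c' i' ->
  x \in region c i -> x \in region c' i' -> (c, i) = (c', i').
Proof.
have rS j : 1 <= j <= l -> region 2 j = vset (hS H j) by [].
case: c => [|[|[|c]]]; case: c' => [|[|[|c']]]; rewrite /valid_index /= ?andbT ?andbF //
  => il jl xi xj.
- by rewrite (region0_inj il jl xi xj).
- by have := region01_disj il jl xi; rewrite xj.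
- by have := region0_notS il jl xi; rewrite xj.
- by have := region01_disj jl il xj; rewrite xi.
- by rewrite (region1_inj il jl xi xj).
- by have := region12_disj il jl xi; rewrite xj.
- by have := region0_notS jl il xj; rewrite xi.
- by have := region12_disj jl il xj; rewrite xi.
- congr (_, _); apply: contraTeq xj => /(hS_disj H il jl) d.
  by rewrite (disjointFr d).
Qed.

Lemma connects_vset (A B : {set T}) p : connects G A B p -> {subset p <= vset G}.
Proof. by case: p => [//|u p] /and5P[_ _ /allP]. Qed.

Lemma region_vset c i x : valid_index c i -> x \in region c i -> x \in vset G.
Proof.
case: c => [|[|[|c]]]; rewrite /valid_index /= ?andbT ?andbF // => il.
- rewrite !inE => /andP[_ /orP[xC | /existsP[a]]]; last exact/connects_vset/hQ_conn.
  by case: (hC_sub H il) => -[/subsetP s _] _; apply: s.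
- by rewrite inE => /existsP[a /inner_sub]; apply/connects_vset/hP_conn.
- by case: (hS_sub H il) => -[/subsetP s _] _; apply: s.
Qed.

Section Cluster.
Variable i : nat.
Hypothesis il : 1 <= i <= l.
Let CQ := add_paths (hC H i) (hQ H i).

Lemma add_paths_subrel : subrel (edge CQ) (edge G).
Proof.
have G_edge a x y : infix [:: x; y] (hQ H i a) -> edge G x y.
  move/infix_path; apply; have := hQ_conn H il a.
  by case: (hQ H i a) => [//|u p] /and5P[].
move=> x y /orP[|/andP[_ /existsP[a /orP[|]]]].
- by case: (hC_sub H il) => -[_ s] _; apply: s.
- exact: G_edge.
- by rewrite edge_sym; apply: G_edge.
Qed.

(** Such a vertex can only be the last one of a single path of Q_i, and its neighbour is its
    predecessor there. Hence a crossbar path, although it lives in the union of C_i and Q_i, cannot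
    pass through S_i. *)
Lemma S_vertex_leaf x y y' : x \in vset (hS H i) -> edge CQ x y -> edge CQ x y' -> y = y'.
Proof.
move=> xS.
have pre y0 : edge CQ x y0 -> exists a, infix [:: y0; x] (hQ H i a).
  case/orP=> [/edge_vset xC | /andP[_ /existsP[a /orP[xy|]]]].
  - by have := notS_of_C il il xC; rewrite xS.
  - have [u [v [[uX _] _ _ _ _]]] := connects_facts (hQ_conn H il a).
    have := hQ_conn H il a; case E: (hQ H i a) xy => [//|u' p] xy /and5P[u'X _ _ _ _].
    case: (infix_inner xy) => [xu' | ].
      by have := notS_of_C il il (hX_C il u'X); rewrite -xu' xS.
    by rewrite -E => /(disjointFr (hQ_inner H a il il)); rewrite inE xS.
  - by exists a.
move=> /pre[a ya] /pre[b yb].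
have xa : x \in hQ H i a by apply: (mem_infix ya); rewrite !inE eqxx orbT.
have xb : x \in hQ H i b by apply: (mem_infix yb); rewrite !inE eqxx orbT.
have Eab : a = b.
  apply: contraTeq xb => nab; have nab' : (i, a) != (i, b) by rewrite xpair_eqE eqxx.
  by rewrite (disjointFr (hQ_disj H il il nab')).
move: ya yb; rewrite Eab => ya yb; apply: pred_uniq ya yb.
by have := hQ_conn H il b; case: (hQ H i b) => [//|u p] /and5P[].
Qed.

Lemma S_not_inner (A B : {set T}) p x : connects CQ A B p -> x \in inner p ->
  x \notin vset (hS H i).
Proof.
case: p => [//|u p] /and5P[_ _ _ pe up] xin; apply/negP=> xS.
have [y [y' [nyy xy xy']]] := inner_two_neighbours (@edge_sym _ CQ) pe up xin.
by rewrite (S_vertex_leaf xS xy xy') eqxx in nyy.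
Qed.

Lemma add_paths_region x : x \in vset CQ -> x \notin vset (hS H i) -> x \in region 0 i.
Proof. by move=> xV xS; rewrite in_setD xS. Qed.

(** [Z v] is meant to be a crossbar path with its hair, cut off before the last vertex [y v], which
    lies in S_i and is left to the matchings there; [b v] and [e v] are the ends of the path. *)
Definition slice (Z : 'I_N -> {set T}) (y b e : 'I_N -> T) : Prop :=
  [/\ forall v, Z v \subset region 0 i, forall v v', v != v' -> [disjoint Z v & Z v'],
      forall v, conn (edge G) (Z v),
      forall v, [/\ b v \in hA H i, b v \in Z v, e v \in hB H i & e v \in Z v] &
      injective y /\ forall v, y v \in hY H i /\ exists2 x, x \in Z v & edge G x (y v)].

Lemma crossbar_slice : crossbar CQ (hA H i) (hB H i) (hY H i) N ->
  exists Z (y b e : 'I_N -> T), slice Z y b e.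
Proof.
move=> [P [Q [dP hair dQ dPQ]]].
have /fin_all_exists[be beP] v : exists be : T * T, [/\ be.1 \in hA H i, be.2 \in hB H i,
    be.1 \in P v, be.2 \in P v & {subset P v <= region 0 i}].
  have := dP.1 v => cP; have [b [e [[bA bP] [eB eP] sP _ ends]]] := connects_facts cP.
  exists (b, e); split=> //= x xP; apply: add_paths_region; first exact: sP.
  case: (ends x xP) => [-> | -> | xin].
  - exact: (notS_of_C il il (hA_C il bA)).
  - exact: (notS_of_C il il (hB_C il eB)).
  - exact: S_not_inner cP xin.
have /fin_all_exists[sy syP] v : exists sy : {set T} * T,
    [/\ sy.1 \subset region 0 i, {subset sy.1 <= Q v}, conn (edge G) sy.1,
     exists2 x, x \in P v & x \in sy.1 &
     [/\ sy.2 \in hY H i, sy.2 \in Q v & exists2 x, x \in sy.1 & edge G x sy.2]].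
  have [x cQ Ex] := hair v.
  have xP : x \in P v.
    by have := set11 x; rewrite -Ex inE => /andP[].
  have [_ _ _ _ /(_ x xP) xR] := beP v.
  have xS := region0_notS il il xR.
  case E: (Q v) cQ => [//|u q] cQ; have := cQ; case/and5P=> /set1P ux lY sV pq uq.
  have lS := hY_S il lY.
  (* The hair has at least two vertices: it starts in region 0, which avoids S_i, and ends in
     S_i. *)
  case/lastP: q E cQ lY sV pq uq lS => [|q y] E cQ lY sV pq uq lS.
    by rewrite /= ux in lS; rewrite lS in xS.
  rewrite last_rcons in lY lS; rewrite rcons_path in pq; case/andP: pq => pq eqy.
  exists ([set z in u :: q], y); split=> /=.
  - apply/subsetP=> z; rewrite inE => zq.
    have zp : z \in u :: rcons q y by rewrite -rcons_cons mem_rcons inE zq orbT.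
    apply: add_paths_region; first exact: (allP sV).
    case: (mem_ends_inner zp) => [-> | zy | zin]; first by rewrite ux.
      move: uq; rewrite -rcons_cons rcons_uniq => /andP[/negP[]].
      by rewrite last_rcons in zy; rewrite -zy.
    exact: S_not_inner cQ zin.
  - by move=> z; rewrite inE => zq; rewrite -rcons_cons mem_rcons inE zq orbT.
  - apply: conn_subrel add_paths_subrel _; exact: (conn_path (@edge_sym _ CQ) pq).
  - by exists x => //; rewrite inE ux mem_head.
  - split=> //; first by rewrite -rcons_cons mem_rcons mem_head.
    by exists (last u q); [rewrite inE mem_last | apply: add_paths_subrel].
exists (fun v => [set z in P v] :|: (sy v).1), (fun v => (sy v).2),
  (fun v => (be v).1), (fun v => (be v).2); split.
- move=> v; rewrite subUset; case: (syP v) => -> _ _ _ _; rewrite andbT.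
  by apply/subsetP=> z; rewrite inE; case: (beP v) => _ _ _ _; apply.
- move=> v v' nvv; have [_ sv _ _ _] := syP v; have [_ sv' _ _ _] := syP v'.
  apply/pred0Pn => -[z /andP[/= /setUP[] zv /setUP[]]]; move: zv; rewrite ?inE.
  + by move=> zv zv'; rewrite (disjointFr (dP.2 _ _ nvv) zv) in zv'.
  + by move=> zv /sv' zv'; rewrite (disjointFr (dPQ _ _ nvv) zv) in zv'.
  + by rewrite eq_sym in nvv; move=> /sv zv zv'; rewrite (disjointFr (dPQ _ _ nvv) zv') in zv.
  + by move=> /sv zv /sv' zv'; rewrite (disjointFr (dQ _ _ nvv) zv) in zv'.
- move=> v; have [_ _ cs [x xP xs] _] := syP v.
  apply: (connU (x := x) (y := x) (@edge_sym _ G) _ cs) => //; rewrite ?inE ?eqxx //.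
  have [? [? [_ _ _ cP _]]] := connects_facts (dP.1 v).
  exact: conn_subrel add_paths_subrel cP.
- by move=> v; case: (beP v) => ? ? ? ? _; rewrite !inE; split=> //; apply/orP; left.
- split.
    move=> v v' Evv; have [_ _ _ _ [_ yv _]] := syP v; have [_ _ _ _ [_ yv' _]] := syP v'.
    apply: contraTeq yv' => nvv; rewrite -Evv.
    by rewrite (disjointFr (dQ _ _ nvv) yv).
  move=> v; have [_ _ _ _ [yY _ [x xs ex]]] := syP v; split=> //.
  by exists x => //; rewrite inE xs orbT.
Qed.

End Cluster.
End System.

(** * Joining consecutive odd clusters through an even one *)

Section Rows.
Variables (T : finType) (G : graph T) (l w N : nat) (H : hairy_path_of_sets G l w).
Implicit Types (i j c t : nat) (x z : T) (v : 'I_N).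
Notation slice := (@slice T G l w N H).
Notation region := (region H).

Lemma disjoint_paths_ends (F : graph T) (A B : {set T}) k (P : 'I_k -> seq T) :
    disjoint_paths F A B P -> exists f g : 'I_k -> T,
  [/\ forall a, f a \in A /\ f a \in P a, forall a, g a \in B /\ g a \in P a &
      forall a z, z \in P a -> [\/ z = f a, z = g a | z \in inner (P a)]].
Proof.
move=> dP; have /fin_all_exists[fg fgP] a : exists fg : T * T,
    [/\ fg.1 \in A /\ fg.1 \in P a, fg.2 \in B /\ fg.2 \in P a &
      forall z, z \in P a -> [\/ z = fg.1, z = fg.2 | z \in inner (P a)]].
  have [x [y [xA yB _ _ ends]]] := connects_facts (dP.1 a).
  by exists (x, y).
by exists (fun a => (fg a).1), (fun a => (fg a).2); split=> a; case: (fgP a).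
Qed.

Lemma linked_paths (F : graph T) (A B A1 B1 : {set T}) n : linked F A B ->
    A1 \subset A -> B1 \subset B -> #|A1| = n -> #|B1| = n ->
  exists P : 'I_n -> seq T, disjoint_paths F A1 B1 P.
Proof. by move=> lk sA sB cA cB; have := lk _ _ sA sB; rewrite cA cB minnn. Qed.

Lemma hP_disjoint_paths i : 1 <= i < l ->
  disjoint_paths G (hB H i) (hA H i.+1) (hP H i).
Proof.
move=> il; split=> [a | a b nab]; first exact: hP_conn.
by apply: hP_disj => //; rewrite xpair_eqE eqxx.
Qed.

Definition connector i (Z Z' K : 'I_N -> {set T}) : Prop :=
  [/\ forall v x, x \in K v -> [\/ x \in region 1 i, x \in region 0 i.+1 | x \in region 1 i.+1],
      forall v v', v != v' -> [disjoint K v & K v'] &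
      forall v, conn (edge G) (Z v :|: K v :|: Z' v)].

(** The exits of the first slice are carried forward along P_i into A_(i+1), the entries of the
    second backward along P_(i+1) into B_(i+1), and the two resulting sets of [N] vertices are
    linked inside C_(i+1). *)
Lemma slice_connector i Z y b e Z' y' b' e' : 1 <= i -> i.+2 <= l -> N <= w ->
    slice i Z y b e -> slice i.+2 Z' y' b' e' ->
  exists (tau : 'I_N -> 'I_N) K, injective tau /\ connector i Z (Z' \o tau) K.
Proof.
move=> i1 i2l Nw [ZR Zd Zc Zbe _] [ZR' Zd' Zc' Zbe' _].
have il : 1 <= i < l by lia.
have il' : 1 <= i.+1 < l by lia.
have il1 : 1 <= i.+1 <= l by lia.
have d1 := hP_disjoint_paths il; have d2 := hP_disjoint_paths il'.
have [f1 [g1 [f1P g1P ends1]]] := disjoint_paths_ends d1.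
have [f2 [g2 [f2P g2P ends2]]] := disjoint_paths_ends d2.
have [_ cB] : hB H i \subset vset (hC H i) /\ #|hB H i| = w by apply: hB_sub; lia.
have [_ cA] : hA H i.+2 \subset vset (hC H i.+2) /\ #|hA H i.+2| = w by apply: hA_sub; lia.
have /fin_all_exists[p1 p1P] v : exists a : 'I_w, e v = f1 a.
  have [_ _ eB _] := Zbe v.
  by apply: (ends_onto d1 cB) => // a; case: (f1P a).
have /fin_all_exists[p2 p2P] v : exists a : 'I_w, b' v = g2 a.
  have [bA _ _ _] := Zbe' v.
  by apply: (ends_onto d2 cA) => // a; case: (g2P a).
have e_inj : injective e.
  move=> v v' Ev; have [_ _ _ ev] := Zbe v; have [_ _ _ ev'] := Zbe v'.
  by apply: contraTeq ev' => nvv; rewrite -Ev (disjointFr (Zd _ _ nvv) ev).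
have b_inj : injective b'.
  move=> v v' Ev; have [_ ev _ _] := Zbe' v; have [_ ev' _ _] := Zbe' v'.
  by apply: contraTeq ev' => nvv; rewrite -Ev (disjointFr (Zd' _ _ nvv) ev).
have g1_inj : injective g1 by apply: (ends_injective d1) => a; case: (g1P a).
have f2_inj : injective f2 by apply: (ends_injective d2) => a; case: (f2P a).
have p1_inj : injective p1 by move=> v v' Ev; apply: e_inj; rewrite !p1P Ev.
have p2_inj : injective p2 by move=> v v' Ev; apply: b_inj; rewrite !p2P Ev.
pose A1 := [set g1 (p1 v) | v in [set: 'I_N]].
pose B1 := [set f2 (p2 v) | v in [set: 'I_N]].
have cA1 : #|A1| = N.
  by rewrite card_imset ?cardsT ?card_ord //; apply: inj_comp g1_inj p1_inj.
have cB1 : #|B1| = N.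
  by rewrite card_imset ?cardsT ?card_ord //; apply: inj_comp f2_inj p2_inj.
have sA1 : A1 \subset hA H i.+1.
  by apply/subsetP=> _ /imsetP[v _ ->]; case: (g1P (p1 v)).
have sB1 : B1 \subset hB H i.+1.
  by apply/subsetP=> _ /imsetP[v _ ->]; case: (f2P (p2 v)).
have [Q dQ] := linked_paths (@hAB_linked _ _ _ _ H _ il1) sA1 sB1 cA1 cB1.
have [f3 [g3 [f3P g3P ends3]]] := disjoint_paths_ends dQ.
have g3_inj : injective g3 by apply: (ends_injective dQ) => a; case: (g3P a).
have /fin_all_exists[q qP] v : exists a : 'I_N, g1 (p1 v) = f3 a.
  apply: (ends_onto dQ cA1) => [a | a |]; first by case: (f3P a).
    by case: (f3P a).
  exact: imset_f.
(* The linkage, not a choice of ours, decides which strand of the next slice continues [v]. *)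
have /fin_all_exists[tau tauP] v : exists v', g3 (q v) = f2 (p2 v').
  by have [/imsetP[v' _ ->] _] := g3P (q v); exists v'.
have q_inj : injective q by move=> v v' Ev; apply/p1_inj/g1_inj; rewrite !qP Ev.
have tau_inj : injective tau by move=> v v' Ev; apply/q_inj/g3_inj; rewrite !tauP Ev.
pose K v := [set x in inner (hP H i (p1 v))] :|: [set x in Q (q v)]
  :|: [set x in inner (hP H i.+1 (p2 (tau v)))].
have K1 v x : x \in inner (hP H i (p1 v)) -> x \in region 1 i.
  by move=> xv; rewrite inE; apply/existsP; exists (p1 v).
have K2 v x : x \in Q (q v) -> x \in region 0 i.+1.
  move=> xv; apply: (C_sub_region il1).
  by have [? [? [_ _ sQ _ _]]] := connects_facts (dQ.1 (q v)); apply: sQ.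
have K3 v x : x \in inner (hP H i.+1 (p2 (tau v))) -> x \in region 1 i.+1.
  by move=> xv; rewrite inE; apply/existsP; exists (p2 (tau v)).
have R1 : valid_index l 1 i by [].
have R2 : valid_index l 0 i.+1 by rewrite /valid_index /= andbT.
have R3 : valid_index l 1 i.+1 by [].
have apart (A B : finType) (F : A -> seq T) (f : 'I_N -> A) v v' x :
    (forall a a', a != a' -> [disjoint F a & F a']) -> injective f -> v != v' ->
    x \in F (f v) -> x \in F (f v') -> False.
  move=> dF f_inj nvv xv; have nf : f v != f v' by rewrite (inj_eq f_inj).
  by rewrite (disjointFr (dF _ _ nf) xv).
exists tau, K; split=> //; split.
- move=> v x /setUP[/setUP[] | ]; rewrite in_set => xv.
  + by apply: Or31; apply: K1 xv.
  + by apply: Or32; apply: K2 xv.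
  + by apply: Or33; apply: K3 xv.
- move=> v v' nvv; apply/pred0Pn => -[x /andP[/=]]; rewrite !inE.
  move=> /orP[/orP[] | ] xv /orP[/orP[] | ] xv'.
  + by apply: (apart _ T _ p1 v v' x d1.2 p1_inj nvv); apply: inner_sub.
  + by have := region_inj R1 R2 (K1 _ _ xv) (K2 _ _ xv').
  + by have [/n_Sn] := region_inj R1 R3 (K1 _ _ xv) (K3 _ _ xv').
  + by have := region_inj R2 R1 (K2 _ _ xv) (K1 _ _ xv').
  + by apply: (apart _ T _ q v v' x dQ.2 q_inj nvv).
  + by have := region_inj R2 R3 (K2 _ _ xv) (K3 _ _ xv').
  + by have [/esym/n_Sn] := region_inj R3 R1 (K3 _ _ xv) (K1 _ _ xv').
  + by have := region_inj R3 R2 (K3 _ _ xv) (K2 _ _ xv').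
  + by apply: (apart _ T _ (p2 \o tau) v v' x d2.2 (inj_comp p2_inj tau_inj) nvv); apply: inner_sub.
- move=> v; have Gs := @edge_sym _ G.
  pose P1 := [set x in hP H i (p1 v)]; pose P2 := [set x in hP H i.+1 (p2 (tau v))].
  pose L := [set x in Q (q v)].
  (* The ends of the two outer paths already belong to the slices or to the linkage path, so
     interiors may be replaced by full paths, which are connected and overlap in these ends. *)
  have -> : Z v :|: K v :|: (Z' \o tau) v = Z v :|: P1 :|: L :|: P2 :|: Z' (tau v).
    apply/eqP; rewrite eqEsubset; apply/andP; split; apply/subsetP=> x; rewrite !inE /=.
      move=> /orP[/orP[-> // | /orP[/orP[] | ]] | ->]; rewrite ?orbT //.
      + by move=> /inner_sub ->; rewrite ?orbT.
      + by move=> ->; rewrite ?orbT.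
      + by move=> /inner_sub ->; rewrite ?orbT.
    move=> /orP[/orP[/orP[/orP[-> // | ] | ->] | ] | ->]; rewrite ?orbT //.
    + case/ends1 => [-> | -> | ->]; rewrite ?orbT //.
        by rewrite -p1P; case: (Zbe v) => _ _ _ ->.
      by rewrite qP; case: (f3P (q v)) => _ ->; rewrite ?orbT.
    + case/ends2 => [-> | -> | ->]; rewrite ?orbT //.
        by rewrite -tauP; case: (g3P (q v)) => _ ->; rewrite ?orbT.
      by rewrite -p2P; case: (Zbe' (tau v)) => _ -> _ _; rewrite ?orbT.
  have cP1 : conn (edge G) P1 by have [? [? [_ _ _ ? _]]] := connects_facts (d1.1 (p1 v)).
  have cP2 : conn (edge G) P2.
    by have [? [? [_ _ _ ? _]]] := connects_facts (d2.1 (p2 (tau v))).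
  have cL : conn (edge G) L.
    have [? [? [_ _ _ cL _]]] := connects_facts (dQ.1 (q v)).
    by apply: conn_subrel cL; case: (hC_sub H il1) => -[].
  have [_ _ _ eZ] := Zbe v; have [_ bZ _ _] := Zbe' (tau v).
  have [_ f1p] := f1P (p1 v); have [_ g1p] := g1P (p1 v).
  have [_ f2p] := f2P (p2 (tau v)); have [_ g2p] := g2P (p2 (tau v)).
  have [_ f3p] := f3P (q v); have [_ g3p] := g3P (q v).
  apply: (connU (x := b' (tau v)) (y := b' (tau v)) Gs _ (Zc' _)); rewrite ?eqxx //.
    apply: (connU (x := g3 (q v)) (y := g3 (q v)) Gs _ cP2); rewrite ?eqxx //.
    - apply: (connU (x := f3 (q v)) (y := f3 (q v)) Gs _ cL); rewrite ?eqxx //.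
      + by apply: (connU (x := e v) (y := e v) Gs (Zc v) cP1); rewrite ?eqxx // inE p1P.
      + by rewrite !inE -qP g1p orbT.
      + by rewrite inE.
    - by rewrite !inE g3p orbT.
    - by rewrite inE tauP.
  by rewrite !inE p2P g2p !orbT.
Qed.

End Rows.

(** Disjointness of [A] and [B] excludes one-vertex paths, so the last vertex can be cut off. *)
Lemma connects_split (T : finType) (F : graph T) (A B : {set T}) p :
    connects F A B p -> [disjoint A & B] -> exists x y (Z : {set T}),
  [/\ [/\ x \in A, x \in Z & y \in B], [/\ {subset Z <= p}, y \in p & y \notin Z],
      {subset p <= vset F}, conn (edge F) Z & exists2 z, z \in Z & edge F z y].
Proof.
case: p => [//|x q] /and5P[xA lB /allP sp pq uq] dAB.
case/lastP: q lB sp pq uq => [|q y] lB sp pq uq.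
  by rewrite /= (disjointFr dAB xA) in lB.
rewrite last_rcons in lB; move: pq; rewrite rcons_path => /andP[pq eqy].
have sub z : z \in x :: q -> z \in x :: rcons q y.
  by rewrite -rcons_cons mem_rcons inE orbC => ->.
exists x, y, [set z in x :: q]; split=> //.
- by rewrite inE mem_head.
- split; first by move=> z; rewrite inE; apply: sub.
    by rewrite -rcons_cons mem_rcons mem_head.
  by rewrite inE; move: uq; rewrite -rcons_cons rcons_uniq => /andP[].
- exact: (conn_path (@edge_sym _ F) pq).
- by exists (last x q); rewrite // inE mem_last.
Qed.

(** * Matchings routed inside the clusters S_i *)

Section Matching.
Variables (T : finType) (G S : graph T) (N : nat) (y : 'I_N -> T).
Implicit Types (v : 'I_N) (M : 'I_N -> {set T}).

(** [M v] is the share of row [v] in S_i. It is empty or contains [y v], through which it hangs on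
    the hair. *)
Definition matching_sets M : Prop :=
  [/\ forall v, M v \subset vset S, forall v v', v != v' -> [disjoint M v & M v'],
      forall v, conn (edge G) (M v) & forall v x, x \in M v -> y v \in M v].

Definition joins (sg : 'I_N -> 'I_N) M : Prop := forall v, v != sg v ->
  exists x z, [/\ x \in M v, z \in M (sg v) & edge G x z].

Lemma matching_sets0 : matching_sets (fun=> set0).
Proof.
split=> [v | v v' _ | v x | v x]; rewrite ?inE ?sub0set //.
by rewrite disjoints_subset sub0set.
Qed.

(** Each path of the linkage is given to the row where it starts, except for its last vertex, which
    goes to the row where it ends. A path may run through [y v] for an unmatched [v]; this does no
    harm, as [M v] is then empty. *)
Lemma well_linked_matching (A B : {set 'I_N}) (U : {set T}) :
    subgraph S G -> well_linked S U -> injective y -> (forall v, y v \in U) ->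
    [disjoint A & B] ->
  exists sg, [/\ exists2 M, matching_sets M & joins sg M, involutive sg &
    minn #|A| #|B| <= #|[set v in A | sg v \in B]|].
Proof.
move=> [_ sSG] wl y_inj yU dAB.
have sU (C : {set 'I_N}) : y @: C \subset U.
  by apply/subsetP=> _ /imsetP[v _ ->].
have dU : [disjoint y @: A & y @: B].
  apply/pred0Pn => -[_ /andP[/= /imsetP[v vA ->] /imsetP[v' v'B /y_inj Ev]]].
  by rewrite Ev (disjointFl dAB v'B) in vA.
have [P dP] := wl _ _ (sU A) (sU B) dU.
move: P dP; rewrite !card_imset //; set n := minn _ _ => P dP.
have /fin_all_exists[D DP] a : exists D : 'I_N * 'I_N * {set T},
    [/\ [/\ D.1.1 \in A, y D.1.1 \in D.2 & D.1.2 \in B],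
      [/\ {subset D.2 <= P a}, y D.1.2 \in P a & y D.1.2 \notin D.2],
      {subset P a <= vset S}, conn (edge S) D.2 & exists2 z, z \in D.2 & edge S z (y D.1.2)].
  have [x [z [Z [[/imsetP[u uA ->] uZ /imsetP[v vB ->]] ? ? ? ?]]]] := connects_split (dP.1 a) dU.
  by exists (u, v, Z).
pose f a := (D a).1.1; pose g a := (D a).1.2; pose Z a := (D a).2.
have fA a : f a \in A by case: (DP a) => -[].
have gB a : g a \in B by case: (DP a) => -[].
have fZ a : y (f a) \in Z a by case: (DP a) => -[].
have ZP a : {subset Z a <= P a} by case: (DP a) => _ [].
have gP a : y (g a) \in P a by case: (DP a) => _ [].
have gZ a : y (g a) \notin Z a by case: (DP a) => _ [].
have PS a : {subset P a <= vset S} by case: (DP a).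
have cZ a : conn (edge G) (Z a) by case: (DP a) => _ _ _ cZ _; apply: conn_subrel cZ.
have Zg a : exists2 z, z \in Z a & edge G z (y (g a)).
  by case: (DP a) => _ _ _ _ [z zZ /sSG ez]; exists z.
have fg a a' : f a != g a'.
  by apply: contraTneq (fA a) => ->; rewrite (disjointFl dAB (gB a')).
have f_inj : injective f.
  by move=> a a' Ea; apply: (ends_injective dP (f := y \o f)) => [b|] /=;
    [apply/ZP/fZ | rewrite Ea].
have g_inj : injective g.
  by move=> a a' Ea; apply: (ends_injective dP (f := y \o g)) => [b|] /=;
    [apply: gP | rewrite Ea].
pose sg v := if [pick a | f a == v] is Some a then g a else
             if [pick a | g a == v] is Some a then f a else v.
pose M v := if [pick a | f a == v] is Some a then Z a else
             if [pick a | g a == v] is Some a then [set y (g a)] else set0.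
have pf a : [pick a' | f a' == f a] = Some a.
  by case: pickP => [a' /eqP/f_inj-> // | /(_ a)]; rewrite eqxx.
have pg a : [pick a' | g a' == g a] = Some a.
  by case: pickP => [a' /eqP/g_inj-> // | /(_ a)]; rewrite eqxx.
have pfg a : [pick a' | f a' == g a] = None.
  by case: pickP => [a' | //]; rewrite (negPf (fg a' a)).
have sgf a : sg (f a) = g a by rewrite /sg pf.
have sgg a : sg (g a) = f a by rewrite /sg pfg pg.
have Mf a : M (f a) = Z a by rewrite /M pf.
have Mg a : M (g a) = [set y (g a)] by rewrite /M pfg pg.
have cases v : [\/ exists a, v = f a, exists a, v = g a | sg v = v /\ M v = set0].
  rewrite /sg /M; case: pickP => [a /eqP <- | _]; first by apply: Or31; exists a.
  by case: pickP => [a /eqP <- | _]; [apply: Or32; exists a | apply: Or33].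
exists sg; split.
- exists M.
  + have MP v x : x \in M v -> exists a, x \in P a /\ (v = f a \/ v = g a).
      case: (cases v) => [[a ->] | [a ->] | [_ ->]]; rewrite ?Mf ?Mg ?inE //.
        by move=> /ZP xP; exists a; split=> //; left.
      by move/eqP->; exists a; split=> //; right.
    split.
    * by move=> v; apply/subsetP=> x /MP[a [/PS]].
    * move=> v v' nvv; apply/pred0Pn => -[x /andP[/= xv xv']].
      have [a [xa va]] := MP v x xv; have [a' [xa' va']] := MP v' x xv'.
      have Ea : a = a'.
        by apply: contraTeq xa' => naa; rewrite (disjointFr (dP.2 _ _ naa) xa).
      case: va va' nvv xv xv' => [-> | ->] [-> | ->]; rewrite -Ea ?eqxx // ?Mf ?Mg !inE => _.
        by move=> xZ /eqP xg; have := gZ a; rewrite -xg xZ.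
      by move=> /eqP xg xZ; have := gZ a; rewrite -xg xZ.
    * move=> v; case: (cases v) => [[a ->] | [a ->] | [_ ->]]; rewrite ?Mf ?Mg //.
        exact: conn1.
      by move=> x z; rewrite inE.
    * move=> v x; case: (cases v) => [[a ->] | [a ->] | [_ ->]]; rewrite ?Mf ?Mg ?inE //.
  + move=> v; case: (cases v) => [[a ->] | [a ->] | [-> _]]; rewrite ?eqxx // => _.
      have [z zZ ez] := Zg a; exists z, (y (g a)); rewrite sgf Mf Mg; split=> //.
      exact: set11.
    have [z zZ ez] := Zg a; exists (y (g a)), z; rewrite sgg Mf Mg edge_sym; split=> //.
    exact: set11.
- move=> v; case: (cases v) => [[a ->] | [a ->] | [Ev _]]; last by rewrite !Ev.
    by rewrite sgf sgg.
  by rewrite sgg sgf.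
- rewrite -[n]card_ord -(card_imset _ f_inj); apply: subset_leq_card.
  by apply/subsetP=> _ /imsetP[a _ ->]; rewrite inE fA sgf gB.
Qed.

End Matching.

(** * Contracting the rows together with their matchings *)

Section Blobs.
Variables (T : finType) (G : graph T) (l w N L : nat) (H : hairy_path_of_sets G l w).
Implicit Types (i j c t : nat) (x z : T) (v : 'I_N).
Hypotheses (L_gt0 : 0 < L) (L_small : L.*2 <= l).

Lemma odd_index t : t < L -> 1 <= t.*2.+1 <= l.
Proof. by lia. Qed.

Lemma rows : N <= w ->
    (forall i, 1 <= i <= l -> odd i ->
       crossbar (add_paths (hC H i) (hQ H i)) (hA H i) (hB H i) (hY H i) N) ->
  exists (Z K : nat -> 'I_N -> {set T}) (y : nat -> 'I_N -> T),
  (forall t, t < L -> exists b e, slice H t.*2.+1 (Z t) (y t) b e) /\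
  (forall t, t.+1 < L -> connector H t.*2.+1 (Z t) (Z t.+1) (K t)).
Proof.
move=> N_small odd_crossbar.
have sl t : t < L -> exists D : ('I_N -> {set T}) * ('I_N -> T),
    exists b e, slice H t.*2.+1 D.1 D.2 b e.
  move=> tL; have il := odd_index tL.
  have oi : odd t.*2.+1 by rewrite /= odd_double.
  by have [Z [y [b [e ?]]]] := crossbar_slice il (odd_crossbar _ il oi); exists (Z, y), b, e.
have [D0 _] := sl 0 L_gt0.
have /choice[D DP] t : exists D : ('I_N -> {set T}) * ('I_N -> T),
    t < L -> exists b e, slice H t.*2.+1 D.1 D.2 b e.
  by have [tL | _] := ltnP t L; [have [D ?] := sl t tL; exists D | exists D0].
have /choice[C CP] t : exists C : ('I_N -> 'I_N) * ('I_N -> {set T}), t.+1 < L ->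
    injective C.1 /\ connector H t.*2.+1 (D t).1 ((D t.+1).1 \o C.1) C.2.
  have [tL | _] := ltnP t.+1 L; last by exists (id, fun=> set0).
  have [b [e s1]] := DP t (ltnW tL); have [b' [e' s2]] := DP t.+1 tL.
  have i2l : t.*2.+3 <= l by lia.
  have [tau [K [ti cK]]] := slice_connector (ltn0Sn _) i2l N_small s1 s2.
  by exists (tau, K).
(* Row [v] uses strand [perm t v] of slice [t]; reindexing by the composed permutations gives each
   row one label throughout. *)
pose perm := fix perm t := if t is t'.+1 then (C t').1 \o perm t' else id.
have perm_inj t : t < L -> injective (perm t).
  elim: t => [|t IH] tL /=; first by [].
  by apply: inj_comp (IH (ltnW tL)); case: (CP t tL).
exists (fun t => (D t).1 \o perm t), (fun t => (C t).2 \o perm t), (fun t => (D t).2 \o perm t).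
split=> t tL.
  have [b [e [Z1 Z2 Z3 Z4 [Z5 Z6]]]] := DP t tL; exists (b \o perm t), (e \o perm t).
  have p_inj := perm_inj t tL.
  split.
  - by move=> v; apply: Z1.
  - by move=> v v' nvv; apply: Z2; rewrite (inj_eq p_inj).
  - by move=> v; apply: (Z3 (perm t v)).
  - by move=> v; apply: Z4.
  - by split=> [|v]; [apply: inj_comp | apply: Z6].
have [_ [K1 K2 K3]] := CP t tL; have p_inj := perm_inj t (ltnW tL).
split=> [v | v v' nvv | v] /=.
- exact: (K1 (perm t v)).
- by apply: K2; rewrite (inj_eq p_inj).
- exact: (K3 (perm t v)).
Qed.

Section Assembly.
Variables (Z K : nat -> 'I_N -> {set T}) (y : nat -> 'I_N -> T).
Hypothesis Z_slice : forall t, t < L -> exists b e, slice H t.*2.+1 (Z t) (y t) b e.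
Hypothesis K_connector : forall t, t.+1 < L -> connector H t.*2.+1 (Z t) (Z t.+1) (K t).

Definition playable t (sg : 'I_N -> 'I_N) : Prop :=
  exists2 M, matching_sets G (hS H t.*2.+1) (y t) M & joins G sg M.

Lemma playable_matching t (A B : {set 'I_N}) : t < L -> [disjoint A & B] ->
  exists sg, [/\ playable t sg, involutive sg &
                 minn #|A| #|B| <= #|[set v in A | sg v \in B]|].
Proof.
move=> tL dAB; have il := odd_index tL.
have [b [e [_ _ _ _ [y_inj yY]]]] := Z_slice tL.
have [sS _] := hS_sub H il; have wl := @hY_wl _ _ _ _ H _ il.
apply: (well_linked_matching sS wl y_inj _ dAB) => v.
by case: (yY v).
Qed.

(** Rounds that were not played receive empty sets, so the rows can always run through all [L] odd
    clusters. *)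
Lemma realized_matchings ss : realized playable ss -> exists M : nat -> 'I_N -> {set T},
  (forall t, matching_sets G (hS H t.*2.+1) (y t) (M t)) /\
  (forall v v', union_edge ss v v' -> exists t x z,
     [/\ t < size ss, x \in M t v, z \in M t v' & edge G x z]).
Proof.
elim: ss => [_ | sg ss IH /= [rs [M0 mM0 jM0] _]].
  exists (fun _ _ => set0); split=> [t | v v']; first exact: matching_sets0.
  by rewrite /union_edge /= andbF.
have [M [mM eM]] := IH rs; exists (fun t => if t == size ss then M0 else M t).
split=> [t | v v']; first by case: eqVneq => [-> |].
rewrite /union_edge /= => /andP[nvv /orP[/eqP Ev | hvv]].
  have [|x [z [xM zM exz]]] := jM0 v; first by rewrite Ev.
  by exists (size ss), x, z; rewrite eqxx -Ev.
have [|t [x [z [tss xM zM exz]]]] := eM v v'; first by rewrite /union_edge /= nvv.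
by exists t, x, z; rewrite (ltn_eqF tss) ltnS ltnW.
Qed.

Section Trees.
Variable M : nat -> 'I_N -> {set T}.
Hypothesis M_matching : forall t, matching_sets G (hS H t.*2.+1) (y t) (M t).

(** The slices are repeated on purpose: the union is written as three connected sets, consecutive
    ones overlapping in a slice, so that connectivity is two gluing steps. *)
Fixpoint blob t v : {set T} :=
  if t is t'.+1 then blob t' v :|: (Z t' v :|: K t' v :|: Z t v) :|: (Z t v :|: M t v)
  else Z 0 v :|: M 0 v.

Lemma level_conn t v : t < L -> conn (edge G) (Z t v :|: M t v).
Proof.
move=> tL; have [b [e [_ _ Zc _ [_ yZ]]]] := Z_slice tL.
have [_ _ Mc yM] := M_matching t.
have [-> | [x /yM yMt]] := set_0Vmem (M t v); first by rewrite setU0; apply: (Zc v).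
have [_ [x' x'Z ex']] := yZ v.
by apply: (connU (@edge_sym _ G) (Zc v) (Mc v) x'Z yMt); rewrite ex' orbT.
Qed.

Lemma Z_sub_blob t v : {subset Z t v <= blob t v}.
Proof. by case: t => [|t] x /= xZ; rewrite !inE xZ ?orbT. Qed.

Lemma Z_nonempty t v : t < L -> exists x, x \in Z t v.
Proof. by move=> /Z_slice[b [e [_ _ _ bZ _]]]; exists (b v); case: (bZ v). Qed.

Lemma blob_conn t v : t < L -> conn (edge G) (blob t v).
Proof.
elim: t => [|t IH] tL; first exact: (level_conn (t := 0)).
have [x xZ] := Z_nonempty v (ltnW tL); have [x' x'Z] := Z_nonempty v tL.
have [_ _ cK] := K_connector tL; rewrite [blob _ _]/=.
apply: (connU (x := x') (y := x') (@edge_sym _ G) _ (@level_conn t.+1 v tL)).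
- apply: (connU (x := x) (y := x) (@edge_sym _ G) (IH (ltnW tL)) (cK v)).
  + exact: Z_sub_blob.
  + by rewrite !inE xZ.
  + by rewrite eqxx.
- by rewrite !inE x'Z !orbT.
- by rewrite inE x'Z.
- by rewrite eqxx.
Qed.

Lemma M_sub_blob s t v : s <= t -> {subset M s v <= blob t v}.
Proof.
elim: t => [|t IH]; first by rewrite leqn0 => /eqP-> x xM; rewrite /= !inE xM orbT.
rewrite leq_eqVlt => /orP[/eqP-> | st] x xM; first by rewrite /= !inE xM !orbT.
by rewrite /= !inE IH.
Qed.

(* The only family of pieces of the blobs that meets region c i. *)
Definition piece c i : 'I_N -> {set T} :=
  if c == 2 then M i.-1./2 else if (c == 0) && odd i then Z i.-1./2 else K i.-1./2.

(** The map from [i] to [i.-1./2] sends the clusters 2t+1 and 2t+2 to round [t]. The guard records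
    that a connector piece comes with a next slice, as needed to apply [K_connector]. *)
Lemma mem_blob t v x : t < L -> x \in blob t v -> exists c i,
  [/\ valid_index l c i, i.-1./2 < L, (c == 1) || ((c == 0) && ~~ odd i) ==> (i.-1./2.+1 < L),
      x \in region H c i & x \in piece c i v].
Proof.
have HZ s : s < L -> x \in Z s v -> exists c i, [/\ valid_index l c i, i.-1./2 < L,
    (c == 1) || ((c == 0) && ~~ odd i) ==> (i.-1./2.+1 < L),
    x \in region H c i & x \in piece c i v].
  move=> sL xZ; exists 0, s.*2.+1; have [b [e [ZR _ _ _ _]]] := Z_slice sL.
  rewrite /piece /= odd_double doubleK; split=> //.
    by rewrite /valid_index odd_index.
  exact: (subsetP (ZR v)).
have HM s : s < L -> x \in M s v -> exists c i, [/\ valid_index l c i, i.-1./2 < L,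
    (c == 1) || ((c == 0) && ~~ odd i) ==> (i.-1./2.+1 < L),
    x \in region H c i & x \in piece c i v].
  move=> sL xM; exists 2, s.*2.+1; have [MS _ _ _] := M_matching s.
  rewrite /piece /= doubleK; split=> //.
    by rewrite /valid_index odd_index.
  exact: (subsetP (MS v)).
elim: t => [|t IH] tL /=; first by case/setUP; [apply: HZ | apply: HM].
case/setUP=> [/setUP[/(IH (ltnW tL)) // | /setUP[/setUP[|] | ]] | /setUP[]].
- exact/HZ/ltnW.
- move=> xK; have [KR _ _] := K_connector tL.
  have tl : 0 < t.*2.+1 < l /\ 0 < t.*2.+2 < l by lia.
  have hu : (t.*2.+1)./2 = t by rewrite /= uphalf_double.
  case: (KR v x xK) => xR; [exists 1, t.*2.+1 | exists 0, t.*2.+2 | exists 1, t.*2.+2].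
  + by rewrite /piece /valid_index /= doubleK; split=> //; lia.
  + rewrite /piece /valid_index /= odd_double /= uphalf_double; split=> //; lia.
  + rewrite /piece /valid_index /= uphalf_double; split=> //; lia.
- exact: HZ.
- exact: HZ.
- exact: HM.
Qed.

Lemma piece_disjoint c i v v' : i.-1./2 < L ->
    (c == 1) || ((c == 0) && ~~ odd i) ==> (i.-1./2.+1 < L) -> c <= 2 ->
  v != v' -> [disjoint piece c i v & piece c i v'].
Proof.
rewrite /piece => iL iK c2 nvv; case: eqP => [_ | c_neq2].
  by have [_ dM _ _] := M_matching i.-1./2; apply: dM.
case: ifP => cZ; first by have [b [e [_ dZ _ _ _]]] := Z_slice iL; apply: dZ.
have iL' : i.-1./2.+1 < L.
  by apply: (implyP iK); move: cZ c_neq2 c2; case: c {iK} => [|[|[|c]]] //= ->.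
by have [_ dK _] := K_connector iL'; apply: dK.
Qed.

(** A common vertex lies in a single region, where both blobs use the same family of pieces, and the
    pieces of one family are disjoint. *)
Lemma blob_disjoint t v v' : t < L -> v != v' -> [disjoint blob t v & blob t v'].
Proof.
move=> tL nvv; apply/pred0Pn => -[x /andP[/= xv xv']].
have [c [i [ci iL iK xR xp]]] := mem_blob tL xv.
have [c' [i' [ci' _ _ xR' xp']]] := mem_blob tL xv'.
case: (region_inj ci ci' xR xR') xp' => <- <- xp'.
have c2 : c <= 2 by move: ci; rewrite /valid_index; case: eqP => [-> | _ /andP[]].
by rewrite (disjointFr (piece_disjoint iL iK c2 nvv) xp) in xp'.
Qed.

Lemma blob_vset t v : t < L -> {subset blob t v <= vset G}.
Proof. by move=> tL x /(mem_blob tL)[c [i [ci _ _ xR _]]]; apply: (region_vset ci xR). Qed.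

End Trees.

Lemma realized_blobs ss : realized playable ss -> size ss <= L ->
  exists W : 'I_N -> {set T},
  [/\ forall v, exists x, x \in W v, forall v, {subset W v <= vset G},
      forall v v', v != v' -> [disjoint W v & W v'], forall v, conn (edge G) (W v) &
      forall v v', union_edge ss v v' -> exists x z, [/\ x \in W v, z \in W v' & edge G x z]].
Proof.
move=> rs ssL; have [M [mM eM]] := realized_matchings rs.
have tL : L.-1 < L by rewrite prednK.
exists (blob M L.-1); split.
- by move=> v; have [x xZ] := Z_nonempty v tL; exists x; apply: Z_sub_blob.
- by move=> v; apply: (blob_vset mM).
- by move=> v v'; apply: (blob_disjoint mM).
- by move=> v; apply: (blob_conn mM).
- move=> v v' /eM[t [x [z [tss xM zM exz]]]]; exists x, z.
  have tL1 : t <= L.-1 by rewrite -ltnS prednK //; apply: leq_trans tss ssL.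
  by split=> //; apply: M_sub_blob tL1 _ _.
Qed.

End Assembly.

End Blobs.

(** * The grid minor *)

Section Minor.
Variables (T : finType) (G : graph T).

Lemma induced_sym (Z : {set T}) : symmetric (within (edge G) Z).
Proof. exact/within_sym/edge_sym. Qed.

Lemma induced_irr (Z : {set T}) : irreflexive (within (edge G) Z).
Proof. by move=> x; rewrite /within /= edge_irr !andbF. Qed.

Lemma induced_in (Z : {set T}) x y : within (edge G) Z x y -> x \in Z.
Proof. by case/and3P. Qed.

Definition induced (Z : {set T}) : graph T :=
  Graph (induced_sym Z) (induced_irr Z) (@induced_in Z).

Lemma minor_of_partial_model (S I : finType) (K : graph S) (e : rel I)
    (F : S -> {set I}) (W : I -> {set T}) :
    partial_model e (edge K) setT F ->
    (forall v, exists x, x \in W v) -> (forall v, {subset W v <= vset G}) ->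
    (forall v v', v != v' -> [disjoint W v & W v']) ->
    (forall v, conn (edge G) (W v)) ->
    (forall v v', e v v' -> exists x z, [/\ x \in W v, z \in W v' & edge G x z]) ->
  minor K G.
Proof.
move=> [F1 F2 F3] Wn WV Wd Wc We.
exists (fun u => induced (\bigcup_(v in F u) W v)); split=> [u _ | u u' _ _ nuu | u u' huu].
- have [/set0Pn[v vF] Fc] := F1 u (in_setT _); split.
    split=> [|x y /and3P[] //].
    by apply/subsetP=> x /bigcupP[v' _]; apply: WV.
  split.
    by have [x xW] := Wn v; apply/set0Pn; exists x; apply/bigcupP; exists v.
  apply: (@conn_bigcup _ _ _ e _ _ Fc) => [v' _ | v1 v2 _ _]; first exact: Wc.
  exact: We.
- apply/pred0Pn => -[x /andP[/= /bigcupP[v vF xv] /bigcupP[v' vF' xv']]].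
  have nvv : v != v'.
    apply: contraTneq vF' => <-.
    by rewrite (disjointFr (F2 u u' (in_setT _) (in_setT _) nuu) vF).
  by rewrite (disjointFr (Wd _ _ nvv) xv) in xv'.
- have [v [v' [vF vF' /We[x [z [xv zv exz]]]]]] := F3 u u' (in_setT _) (in_setT _) huu.
  by exists x, z; split=> //; apply/bigcupP; [exists v | exists v'].
Qed.

(** Covers the small [g], for which the grid side is 1. *)
Lemma minor_grid1 (C : graph T) : subgraph C G -> Defs.connected C -> minor (grid 1) G.
Proof.
move=> sC cC; exists (fun=> C); split=> // [[a b] [a' b'] _ _ | [a b] [a' b']].
  by rewrite !(ord1 a) !(ord1 a') !(ord1 b) !(ord1 b') eqxx.
by rewrite !(ord1 a) !(ord1 a') !(ord1 b) !(ord1 b') edge_irr.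
Qed.

End Minor.

(** * Choice of the parameters *)

Lemma grid_degree n (u : 'I_n * 'I_n) : #|[set v | grid_edge u v]| <= 4.
Proof.
pose D (p : pred ('I_n * 'I_n)) := [set v | p v].
have le1 (p : pred ('I_n * 'I_n)) : (forall v v', p v -> p v' -> v = v') -> #|D p| <= 1.
  by move=> H; apply/card_le1_eqP => v v'; rewrite !inE => pv pv'; apply: H.
pose p1 (v : 'I_n * 'I_n) := (u.1 == v.1) && (u.2.+1 == v.2).
pose p2 (v : 'I_n * 'I_n) := (u.1 == v.1) && (v.2.+1 == u.2).
pose p3 (v : 'I_n * 'I_n) := (u.2 == v.2) && (u.1.+1 == v.1).
pose p4 (v : 'I_n * 'I_n) := (u.2 == v.2) && (v.1.+1 == u.1).
have sub : [set v | grid_edge u v] \subset (D p1 :|: D p2) :|: (D p3 :|: D p4).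
  apply/subsetP=> v; rewrite !inE /grid_edge /succ_or_pred /p1 /p2 /p3 /p4 /=.
  by rewrite !andb_orr.
have c1 : #|D p1| <= 1.
  apply: le1 => -[a b] [a' b'] /andP[/= /eqP<- /eqP E] /andP[/= /eqP<- /eqP E'].
  by congr (_, _); apply: val_inj; rewrite /= -E -E'.
have c2 : #|D p2| <= 1.
  apply: le1 => -[a b] [a' b'] /andP[/= /eqP<- /eqP E] /andP[/= /eqP<- /eqP E'].
  by congr (_, _); apply: val_inj; apply: succn_inj; rewrite /= E E'.
have c3 : #|D p3| <= 1.
  apply: le1 => -[a b] [a' b'] /andP[/= /eqP<- /eqP E] /andP[/= /eqP<- /eqP E'].
  by congr (_, _); apply: val_inj; rewrite /= -E -E'.
have c4 : #|D p4| <= 1.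
  apply: le1 => -[a b] [a' b'] /andP[/= /eqP<- /eqP E] /andP[/= /eqP<- /eqP E'].
  by congr (_, _); apply: val_inj; apply: succn_inj; rewrite /= E E'.
apply: leq_trans (subset_leq_card sub) _.
have := (leq_card_setU (D p1 :|: D p2) (D p3 :|: D p4)).1.
have := (leq_card_setU (D p1) (D p2)).1; have := (leq_card_setU (D p3) (D p4)).1; lia.
Qed.

(** The 50k clusters give 25k rounds, more than the 9 * 2k needed for N = 2^(2k). The separator size
    s = N/(600k) makes 24 * 25k * s <= N, and q = 2400k makes q s at least 2N, half of it for the
    branch sets. Then q n^2 r <= 2400k * n^2 * 40000k^2 <= 10^8 k^3 n^2 <= N. *)
Lemma grid_minor_of_crossbars (R : realType) k n (T : finType) (G : graph T) w
    (H : hairy_path_of_sets G (50 * k) w) : 0 < k -> 4 ^ k <= w ->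
    (forall i, 1 <= i <= 50 * k -> odd i ->
       crossbar (add_paths (hC H i) (hQ H i)) (hA H i) (hB H i) (hY H i) (4 ^ k)) ->
    0 < n -> 10 ^ 8 * (k ^ 3 * n ^ 2) <= 4 ^ k -> minor (grid n) G.
Proof.
move=> k0 Nw cb n0 n_small; set N := 4 ^ k in Nw cb n_small.
have L0 : 0 < 25 * k by lia.
have Ll : (25 * k).*2 <= 50 * k by lia.
have [Z [K [y [Z_slice K_conn]]]] := rows L0 Ll Nw cb.
have N0 : 0 < N by rewrite expn_gt0.
have k1 : 0 < k ^ 3 * n ^ 2 by rewrite muln_gt0 !expn_gt0 k0 n0.
have kk : k <= k ^ 3 * n ^ 2.
  have : k ^ 1 <= k ^ 3 by rewrite leq_pexp2l.
  by rewrite expn1 => /leq_trans; apply; rewrite leq_pmulr // expn_gt0 n0.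
(* [a] stands for 100 and is hidden, so that the arithmetic below does not compute with large
   numerals. *)
have [a [Ea a0]] : exists a, 600 = 6 * a /\ 0 < a by exists 100.
have {}n_small : 10 ^ 4 * a ^ 2 * (k ^ 3 * n ^ 2) <= N.
  apply: leq_trans n_small; rewrite leq_mul2r; apply/orP; right.
  have -> : a = 10 ^ 2 by lia.
  by rewrite -expnM -expnD leq_exp2l.
pose s := N %/ (6 * a * k).
have V0 : 0 < #|'I_N| by rewrite card_ord.
have Vm : #|'I_N| <= 2 ^ (2 * k) by rewrite card_ord expnM.
have Lm : 9 * (2 * k) < 25 * k by lia.
have sN : 6 * a * k * s <= N by rewrite mulnC leq_trunc_div.
have Ns : N < 6 * a * k * s.+1 by rewrite mulnC ltn_ceil // !muln_gt0 a0 k0.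
have s24 : 24 * (25 * k * s) <= #|'I_N|.
  by rewrite card_ord; apply: leq_trans sN; rewrite -Ea; lia.
have [ss [rss ssL nsep]] :=
  cut_player_wins R (playable_matching L0 Ll Z_slice) V0 Vm Lm s24.
have [W [Wn WV Wd Wc We]] := realized_blobs L0 Ll Z_slice K_conn rss ssL.
pose q := 24 * a * k.
pose r := 1 + 4 * (2 * (q * (2 * k)).+1).
have r_le : r <= 400 * a * k ^ 2.
  have : 0 < a * k ^ 2 by rewrite muln_gt0 a0 expn_gt0 k0.
  have -> : r = 384 * (a * k ^ 2) + 9 by rewrite /r /q; ring.
  by rewrite -[400 * a * _]mulnA; move: (a * k ^ 2) => z z0; lia.
have q0 : 0 < q by rewrite /q !muln_gt0 a0 k0.
have HS : q * (#|{: 'I_n * 'I_n}| * r) + #|'I_N| <= q * s.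
  rewrite card_prod !card_ord.
  have small1 : q * (n * n * r) <= N.
    apply: leq_trans n_small.
    apply: leq_trans (_ : q * (n * n * (400 * a * k ^ 2)) <= _).
      by rewrite !leq_mul2l r_le !orbT.
    have -> : q * (n * n * (400 * a * k ^ 2)) = 96 * 100 * (a ^ 2 * (k ^ 3 * n ^ 2)).
      by rewrite /q; ring.
    by rewrite -[leqRHS]mulnA leq_mul2r; apply/orP; right.
  have small2 : 12 * a * k <= N.
    apply: leq_trans n_small; rewrite -[leqLHS]mulnA -[leqRHS]mulnA; apply: leq_mul => //.
    by apply: leq_mul _ kk; rewrite expnS leq_pmulr // expn_gt0 a0.
  have q2 : q <= 2 * N.
    by have -> : q = 2 * (12 * a * k) by [rewrite /q; ring]; rewrite leq_mul2l small2.
  (* The rounding in [s] costs at most [q <= 2 * N], so 2N remain. *)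
  have qs : 4 * N < q * s.+1.
    by have -> : q * s.+1 = 4 * (6 * a * k * s.+1) by [rewrite /q; ring]; rewrite ltn_pmul2l.
  by move: small1 q2 qs; rewrite mulnS; clear; lia.
have s8 : 8 * s <= #|'I_N|.
  rewrite card_ord; apply: leq_trans sN; rewrite leq_mul2r; apply/orP; right.
  by rewrite -Ea; apply: leq_trans (leq_pmulr 600 k0).
have [F mF] := minor_of_no_separation (union_edge_sym rss) (@grid_sym n) (@grid_irr n)
  (@grid_degree n) nsep q0 Vm (leqnn r) HS s8.
exact: (minor_of_partial_model (K := grid n) mF Wn WV Wd Wc We).
Qed.

(** The largest admissible side is optimal up to a factor 2, and allowing [n = 1] unconditionally
    absorbs all small [k]. *)
Lemma grid_side k : 0 < k -> exists n,
  [/\ 0 < n, n = 1 \/ 10 ^ 8 * (k ^ 3 * n ^ 2) <= 4 ^ k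
    & 4 ^ k <= 10 ^ 8 * (k ^ 3 * (2 * n) ^ 2)].
Proof.
move=> k0; pose P n := (0 < n) && ((n == 1) || (10 ^ 8 * (k ^ 3 * n ^ 2) <= 4 ^ k)).
have P1 : exists n, P n by exists 1.
have Pb n : P n -> n <= 4 ^ k.
  case/andP=> n0 /orP[/eqP-> | ]; first by rewrite expn_gt0.
  apply: leq_trans; apply: leq_trans (_ : n ^ 2 <= _).
    by rewrite expnS leq_pmulr // expn_gt0 n0.
  by rewrite mulnA leq_pmull // muln_gt0 !expn_gt0 k0.
case: (ex_maxnP P1 Pb) => n /andP[n0 n_small] n_max; exists n; split=> //.
  by case/orP: n_small => [/eqP | ]; [left | right].
(* Maximality is applied to [n.+1], which is at most [2 * n]. *)
rewrite leqNgt; apply/negP => lt; have : n < n by apply: n_max; rewrite /P /=;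
  apply/orP; right; apply: leq_trans (ltnW lt); rewrite !leq_mul2l leq_exp2r //; lia.
by rewrite ltnn.
Qed.

Local Open Scope ring_scope.

Theorem theorem3p3 (R : realType) :
  exists (ctilde : nat) (c : R), [/\ (0 < ctilde)%N, 0 < c &
  forall (g : nat), (2 <= g)%N -> (exists k : nat, g = (2 ^ k)%N) ->
  forall (T : finType) (G : graph T), max_degree_le G 3 ->
  forall (l w : nat), l%:R = ctilde%:R * log2 (g%:R : R) -> (g ^ 2 <= w)%N ->
  forall (H : hairy_path_of_sets G l w),
  (forall i : nat, (1 <= i <= l)%N -> odd i ->
     crossbar (add_paths (hC H i) (hQ H i)) (hA H i) (hB H i) (hY H i)
       (g ^ 2)%N) ->
  exists g' : nat,
    minor (grid g') G /\ c * g%:R / log2 (g%:R : R) `^ (3 / 2) <= g'%:R].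
Proof.
(* 10^4 is the square root of the constant 10^8, and the factor 2 is lost in rounding the side. *)
exists 50%N, (10 ^+ 4 * 2)^-1; split=> //.
move=> g g2 [k Eg] T G _ l w; rewrite {}Eg in g2 *.
have k0 : (0 < k)%N by case: k g2.
have -> : log2 ((2 ^ k)%:R : R) = k%:R.
  rewrite /log2 natrX lnXn // -[_ *+ k]mulr_natl mulfK //.
  by rewrite gt_eqF // ln_gt0 // ltr1n.
have -> : ((2 ^ k) ^ 2 = 4 ^ k)%N by rewrite -expnM mulnC expnM.
rewrite -natrM => /eqP; rewrite eqr_nat => /eqP-> Nw H cb.
have [n [n0 n_small n_large]] := grid_side k0.
exists n; split.
  case: n_small => [-> | n_small]; last exact: (grid_minor_of_crossbars R k0 Nw cb n0 n_small).
  have l1 : (1 <= 1 <= 50 * k)%N by rewrite muln_gt0.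
  by have [? ?] := hC_sub H l1; apply: (minor_grid1 (C := hC H 1)).
set x : R := k%:R `^ (3 / 2).
have kR : 0 < k%:R :> R by rewrite ltr0n.
have x0 : 0 < x by apply: powR_gt0.
have x2 : x ^+ 2 = k%:R ^+ 3.
  by rewrite -powR_mulrn ?powR_ge0 // -powRrM divfK // powR_mulrn // ler0n.
rewrite ler_pdivrMr // ler_pdivrMl; last by rewrite mulr_gt0 ?exprn_gt0.
(* Squaring turns k^(3/2) into k^3 and leaves the upper bound on 4^k given by [grid_side]. *)
rewrite -ler_sqr ?nnegrE ?ler0n ?mulr_ge0 ?exprn_ge0 ?(ltW x0) //.
have -> : (10 ^+ 4 * 2 * (n%:R * x)) ^+ 2 = (10 ^ 8 * (k ^ 3 * (2 * n) ^ 2))%:R.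
  by rewrite !(natrM, natrX) !exprMn x2; ring.
by rewrite -natrX ler_nat -expnM mulnC expnM.
Qed.
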